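(* Let $A$ be a Green $\mathcal D$-biset functor. Then the center $ZA$, endowed with its $\mathcal D$-biset functor structure $ZA(u)(t)=\rho_{u_A}\circ t$ and with the product $$t\times s={}^o(t\circ s^o)\in ZA(L\times K)\qquad\text{for } s\in ZA(K),\ t\in ZA(L),\ K,L\in\mathcal D,$$ is a Green $\mathcal D$-biset functor.
   Context: Throughout, $R$ is a commutative unital ring, all groups are finite, and $\mathcal D$ is a non-empty class of finite groups closed under subquotients (so also under isomorphism) and cartesian products. The category $R\mathcal D$ has the groups in $\mathcal D$ as objects, $\mathrm{Hom}_{R\mathcal D}(G,H)=RB(H,G)=R\otimes_{\mathbb Z}B(H,G)$, where $B(H,G)$ is the Grothendieck group of finite $(H,G)$-bisets, and composition is induced by $V\circ U=V\times_G U$; $RB(H,G)$ is identified with $RB(H\times G)$. A $\mathcal D$-biset functor is an $R$-linear functor $R\mathcal D\to R\text{-Mod}$. $\mathrm{Res}^G_K$ (resp. $\mathrm{Ind}_K^G$) is $G$ as a $(K,G)$-biset (resp. $(G,K)$-biset) for an injective homomorphism $K\to G$; $\mathrm{Inf}_Q^G$ (resp. $\mathrm{Def}^G_Q$) is $Q$ as a $(G,Q)$-biset (resp. $(Q,G)$-biset) for a surjective homomorphism $G\to Q$; $\mathrm{Iso}$ is the biset of a group isomorphism (between products of groups: the obvious permutation of factors). Products of morphisms of $R\mathcal D$ are induced by cartesian products of bisets. $\Delta(G)\le G\times G$ is the diagonal. Canonical isomorphisms $(G\times H)\times K\cong G\times(H\times K)$, $1\times G\cong G\cong G\times1$ are used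 as identifications, and $\times$ between groups is often omitted. A Green $\mathcal D$-biset functor is a $\mathcal D$-biset functor $A$ with $R$-bilinear products $A(G)\times A(H)\to A(G\times H)$, $(a,b)\mapsto a\times b$, and an identity element $\varepsilon\in A(1)$, associative and unital up to canonical group isomorphisms, with $A(\varphi\times\psi)(a\times b)=A(\varphi)(a)\times A(\psi)(b)$ for morphisms $\varphi,\psi$ of $R\mathcal D$. There is a unique morphism of Green functors $\upsilon_A:RB\to A$ ($RB$ the Burnside functor), sending a $G$-set $X$ to $A({}_GX_1)(\varepsilon)$. The category $\mathcal P_A$ has objects the groups in $\mathcal D$, $\mathrm{Hom}_{\mathcal P_A}(G,H)=A(HG)$; the composite of $\beta\in A(HG)$ and $\alpha\in A(GK)$ is $\beta\circ\alpha=A(H\times\overleftarrow{G}\times K)(\beta\times\alpha)$, with $\overleftarrow{G}=\mathrm{Def}^{\Delta(G)}_1\circ\mathrm{Res}^{G\times G}_{\Delta(G)}$; the identity of $G$ is $A(\mathrm{Ind}_{\Delta(G)}^{G\times G}\mathrm{Inf}_1^{\Delta(G)})(\varepsilon)$. The endofunctor $\rho_L=-\times L$ of $\mathcal P_A$ sends $G$ to $GL$ and $\alpha\in A(HG)$ to $\alpha\times L=A(\mathrm{Ind}_{HGL}^{HLGL}\mathrm{Inf}_{HG}^{HGL})(\alpha)$ (embedding $(h,g,l)\mapsto(h,l,g,l)$). For $G\in\mathcal D$ and $\beta\in A(LK)$, $G\times\beta=A(\mathrm{Ind}_{GLK}^{GLGK}\mathrm{Inf}_{LK}^{GLK})(\beta)$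 (embedding $(g,l,k)\mapsto(g,l,g,k)$), a morphism $GK\to GL$. The center $ZA(L)$, defined as the natural transformations from the identity functor of the category of $A$-modules to the shift functor $\mathrm{Id}_L$ ($M\mapsto M(-\times L)$), is identified (Yoneda) with the set of natural transformations $t:\mathrm{Id}_{\mathcal P_A}\to\rho_L$, i.e. with families $t_G\in A(GLG)=\mathrm{Hom}_{\mathcal P_A}(G,GL)$, $G\in\mathcal D$, such that $(\alpha\times L)\circ t_G=t_H\circ\alpha$ for all $\alpha\in A(HG)$. Biset structure: for $u\in RB(LK)$, $u_A=\upsilon_{A,LK}(u)\in A(LK)$, the morphisms $G\times u_A$ ($G\in\mathcal D$) form a natural transformation $\rho_{u_A}:\rho_K\to\rho_L$, and $ZA(u)(t)=\rho_{u_A}\circ t$ for $t\in ZA(K)$. Product: for $s\in ZA(K)$, $s^o:\rho_K\to\mathrm{Id}$ is the adjoint natural transformation, with components $s^o_G=A(\mathrm{Iso}_{GKG}^{GGK})(s_G)\in A(GGK)=\mathrm{Hom}_{\mathcal P_A}(GK,G)$ (switching the last two components); then $t\circ s^o:\rho_K\to\rho_L$, and ${}^o(t\circ s^o):\mathrm{Id}\to\rho_{LK}$ is obtained by adjunction, with components $A(\mathrm{Iso}_{GLGK}^{GLKG})(t_G\circ s^o_G)\in A(GLKG)$. The identity element of $ZA$ is the identity natural transformation of $\mathrm{Id}_{\mathcal P_A}=\rho_1$. *)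

(* Defs.v *)
From HB Require Import structures.
From mathcomp Require Import all_boot all_order all_algebra all_fingroup.
From mathcomp Require Import generic_quotient boolp.

Set Implicit Arguments.
Unset Strict Implicit.
Unset Printing Implicit Defensive.

Import GRing.Theory.
Local Open Scope ring_scope.
Local Open Scope quotient_scope.

(** * Finite groups *)

Definition finite_type (T : Type) : Prop :=
  exists n (f : 'I_n -> T), forall x, exists i, f i = x.

Lemma finite_finType (T : finType) : finite_type T.
Proof.
by exists #|T|, enum_val => x; exists (enum_rank x); rewrite enum_rankK.
Qed.

Fact finite_code (T : Type) (hT : finite_type T) :
  {n : nat & {c : (T -> 'I_n) * ('I_n -> T) | cancel c.1 c.2}}.
Proof.
have [n /cid[f fP]] := cid hT; have [g gK] := choice fP.
by exists n, (g, f).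
Qed.

(* A finite type in the above sense, as a finType on the same carrier. *)
Definition fin_type (T : Type) (hT : finite_type T) : Type := T.
HB.instance Definition _ T (hT : finite_type T) :=
  Finite.copy (fin_type hT) (can_type (svalP (projT2 (finite_code hT)))).

(* MathComp's algebraic structures, finite groups included, all live in one
   universe U, so finGroupType itself is too large to index a product of
   R-modules.  Carriers of groups and bisets are therefore taken in Set, which
   is strictly below U: every finite group is isomorphic to such a group (see
   fgroup_isog), and the families (t_G)_G that make up the center then form a
   type in U.  For the same reason finiteness is a Prop in the records below;
   gfin and bfin give back the finGroupType and the finType. *)
Record fgroup := FGroup {
  gcar : Set;
  gfinite : finite_type gcar;
  gop : gcar -> gcar -> gcar;
  gid : gcar;
  ginv : gcar -> gcar;
  gopA : associative gop;
  gop1 : left_id gid gop;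
  gopV : left_inverse gid ginv gop
}.
Definition gtype (G : fgroup) : Type := gcar G.
HB.instance Definition _ G := Finite.copy (gtype G) (fin_type (gfinite G)).
HB.instance Definition _ G :=
  Finite_isGroup.Build (gtype G) (@gopA G) (@gop1 G) (@gopV G).
Definition gfin (G : fgroup) : finGroupType := gtype G.
Coercion gfin : fgroup >-> finGroupType.

Lemma fgroup_isog (gT : finGroupType) :
  exists G : fgroup, [set: gT] \isog [set: G].
Proof.
pose S : Set := {i : nat | (i < #|gT|)%N}.
pose r (x : gT) : S := exist _ (nat_of_ord (enum_rank x)) (ltn_ord _).
pose v (i : S) : gT := enum_val (Ordinal (svalP i)).
have rv i : r (v i) = i by apply: val_inj; rewrite /= enum_valK.
have vr x : v (r x) = x.
  by rewrite -[RHS]enum_rankK; congr enum_val; exact: val_inj.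
have finS : finite_type S.
  exists #|gT|, (r \o enum_val) => i; exists (enum_rank (v i)).
  by rewrite /= enum_rankK.
have mA : associative (fun i j => r (v i * v j)%g).
  by move=> i j k; rewrite !vr mulgA.
have m1 : left_id (r 1%g) (fun i j => r (v i * v j)%g).
  by move=> i; rewrite vr mul1g rv.
have mV : left_inverse (r 1%g) (fun i => r (v i)^-1%g)
    (fun i j => r (v i * v j)%g).
  by move=> i; rewrite vr mulVg.
exists (FGroup finS mA m1 mV).
set G := FGroup _ _ _ _.
have rM : {in [set: gT] &, {morph (r : gT -> G) : x y / (x * y)%g}}.
  by move=> x y _ _; rewrite -[in LHS](vr x) -[in LHS](vr y).
apply/isogP; exists (Morphism rM).
  by apply/injmP => x y _ _ /(can_inj vr).
apply/setP=> i; rewrite inE; apply/imsetP.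
by exists (v i); rewrite ?inE //= rv.
Qed.

Definition gone : fgroup.
Proof.
refine (@FGroup unit (finite_finType unit)
  (fun _ _ => tt) tt (fun _ => tt) _ _ _) => //.
by case.
Defined.

Definition gprod (G H : fgroup) : fgroup.
Proof.
refine (@FGroup (gcar G * gcar H)%type (finite_finType (G * H)%type)
  (fun x y => (gop x.1 y.1, gop x.2 y.2)) (gid G, gid H)
  (fun x => (ginv x.1, ginv x.2)) _ _ _).
- by move=> x y z; rewrite /= !gopA.
- by case=> x y; rewrite /= !gop1.
- by case=> x y; rewrite /= !gopV.
Defined.
Notation "G *g H" := (gprod G H) (at level 40, left associativity).

Record groupClass := GroupClass {
  inclass :> fgroup -> Prop;
  class_ne : exists G, inclass G;
  class_subq : forall (G H : fgroup) (K N : {group G}),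
    inclass G -> (N <| K)%g -> [set: H] \isog (K / N)%g -> inclass H;
  class_prod : forall G H, inclass G -> inclass H -> inclass (G *g H)
}.

Record obj (D : groupClass) := Obj { ogrp :> fgroup; ogrpP : D ogrp }.

Fact class_one (D : groupClass) : D gone.
Proof.
have [G DG] := class_ne D.
apply: (class_subq (K := 1%G) (N := 1%G) DG (normal_refl _)).
apply: trivial_isog; last by rewrite /= trivg_quotient.
by apply/setP=> x; rewrite !inE; apply/esym/eqP; case: x.
Qed.

Definition oone (D : groupClass) : obj D := Obj (class_one D).
Definition oprod (D : groupClass) (G H : obj D) : obj D :=
  Obj (class_prod (ogrpP G) (ogrpP H)).
Arguments oone {D}.
Notation "G ** H" := (oprod G H) (at level 40, left associativity).

(** * Group homomorphisms *)

Definition mkhom (K G : fgroup) (f : K -> G)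
    (fM : {morph f : x y / (x * y)%g}) : {multiplicative K -> G} :=
  HB.pack f (isMultiplicative.Build K G f fM).
Local Notation hom f := (@mkhom _ _ f (fun _ _ => erefl)).

Section Homs.
Variables G H K L : fgroup.

Definition hid : {multiplicative G -> G} := hom (fun g => g).
Definition hto1 : {multiplicative G -> gone} := hom (fun _ => tt : gone).

(* The diagonal embedding; it identifies G with Delta(G). *)
Definition hdiag : {multiplicative G -> G *g G} :=
  hom (fun g => (g, g) : G *g G).

Definition hfst : {multiplicative G *g H -> G} :=
  hom (fun x : G *g H => x.1 : G).
Definition hsnd : {multiplicative G *g H -> H} :=
  hom (fun x : G *g H => x.2 : H).

(* The canonical identifications between products. *)
Definition hassoc : {multiplicative G *g H *g K -> G *g (H *g K)} :=
  hom (fun x : G *g H *g K => (x.1.1, (x.1.2, x.2)) : G *g (H *g K)).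
Definition hunitl : {multiplicative gone *g G -> G} :=
  hom (fun x : gone *g G => x.2 : G).
Definition hunitr : {multiplicative G *g gone -> G} :=
  hom (fun x : G *g gone => x.1 : G).
Definition hmid : {multiplicative G *g H *g (K *g L) -> G *g (H *g K) *g L} :=
  hom (fun x : G *g H *g (K *g L) =>
         (x.1.1, (x.1.2, x.2.1), x.2.2) : G *g (H *g K) *g L).
Definition hdel1 : {multiplicative G *g gone *g H -> G *g H} :=
  hom (fun x : G *g gone *g H => (x.1.1, x.2) : G *g H).
Definition hins1 : {multiplicative G *g H -> G *g gone *g H} :=
  hom (fun x : G *g H => (x.1, tt, x.2) : G *g gone *g H).

(* (h, g, l) |-> (h, l, g, l) *)
Definition hrho : {multiplicative G *g H *g L -> G *g L *g (H *g L)} :=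
  hom (fun x : G *g H *g L =>
         (x.1.1, x.2, (x.1.2, x.2)) : G *g L *g (H *g L)).

(* (g, l, k) |-> (g, l, g, k) *)
Definition hlam : {multiplicative G *g (L *g K) -> G *g L *g (G *g K)} :=
  hom (fun x : G *g (L *g K) =>
         (x.1, x.2.1, (x.1, x.2.2)) : G *g L *g (G *g K)).

(* (g, k, h) |-> (g, h, k) *)
Definition hswap : {multiplicative G *g K *g H -> G *g (H *g K)} :=
  hom (fun x : G *g K *g H => (x.1.1, (x.2, x.1.2)) : G *g (H *g K)).

(* (g, l, h, k) |-> (g, l, k, h) *)
Definition htransp :
    {multiplicative G *g L *g (H *g K) -> G *g (L *g K) *g H} :=
  hom (fun x : G *g L *g (H *g K) =>
         (x.1.1, (x.1.2, x.2.2), x.2.1) : G *g (L *g K) *g H).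

End Homs.

(** * Bisets *)

Record biset (H G : fgroup) := Biset {
  bcar : Set;
  bfinite : finite_type bcar;
  bl : H -> bcar -> bcar;
  br : bcar -> G -> bcar;
  bl1 : forall x, bl 1%g x = x;
  blM : forall h h' x, bl (h * h')%g x = bl h (bl h' x);
  br1 : forall x, br x 1%g = x;
  brM : forall x g g', br x (g * g')%g = br (br x g) g';
  blr : forall h x g, br (bl h x) g = bl h (br x g)
}.
Definition bfin H G (X : biset H G) : finType := fin_type (bfinite X).
Coercion bfin : biset >-> finType.

HB.instance Definition _ H G := gen_eqMixin (biset H G).
HB.instance Definition _ H G := gen_choiceMixin (biset H G).

Definition biso H G (X Y : biset H G) : Prop := exists f : X -> Y,
  [/\ bijective f, forall h x, f (bl h x) = bl h (f x)
    & forall x g, f (br x g) = br (f x) g].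

Section BisetConstructions.

(* For K <= G this is Ind_K^G, for a surjective f : K -> G it is Def^K_G, and
   for an isomorphism it is Iso(f): the set G, with k acting on the right by
   right multiplication by f(k). *)
Definition bInd (K G : fgroup) (f : {multiplicative K -> G}) : biset G K.
Proof.
refine (@Biset G K (gcar G) (gfinite G)
  (fun g x => g * (x : G) : G)%g (fun x k => (x : G) * f k : G)%g _ _ _ _ _).
- by move=> x; exact: (@mul1g G).
- by move=> h h' x; exact/esym/(@mulgA G).
- move=> x; suff -> : f 1%g = 1%g by exact: (@mulg1 G).
  by apply: (mulgI (f 1%g)); rewrite -gmulfM !mulg1.
- by move=> x g g'; rewrite gmulfM (@mulgA G).
- by move=> h x g; exact/esym/(@mulgA G).
Defined.

(* Res^G_K for f injective, Inf_G^K for f surjective. *)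
Definition bRes (K G : fgroup) (f : {multiplicative K -> G}) : biset K G.
Proof.
refine (@Biset K G (gcar G) (gfinite G)
  (fun k x => f k * (x : G) : G)%g (fun x g => (x : G) * g : G)%g _ _ _ _ _).
- move=> x; suff -> : f 1%g = 1%g by exact: (@mul1g G).
  by apply: (mulgI (f 1%g)); rewrite -gmulfM !mulg1.
- by move=> h h' x; rewrite gmulfM -(@mulgA G).
- by move=> x; exact: (@mulg1 G).
- by move=> x g g'; exact: (@mulgA G).
- by move=> h x g; exact/esym/(@mulgA G).
Defined.

Definition bsum H G (X Y : biset H G) : biset H G.
Proof.
refine (@Biset H G (bcar X + bcar Y)%type (finite_finType (X + Y)%type)
  (fun h z => match z with inl x => inl (bl h x) | inr y => inr (bl h y) end)
  (fun z g => match z with inl x => inl (br x g) | inr y => inr (br y g) end)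
  _ _ _ _ _).
- by case=> x; rewrite bl1.
- by move=> h h' []x; rewrite blM.
- by case=> x; rewrite br1.
- by move=> []x g g'; rewrite brM.
- by move=> h []x g; rewrite blr.
Defined.

Definition bprod H G H' G' (X : biset H G) (Y : biset H' G') :
  biset (H *g H') (G *g G').
Proof.
refine (@Biset (H *g H') (G *g G') (bcar X * bcar Y)%type
  (finite_finType (X * Y)%type)
  (fun h z => (bl (h : H * H').1 z.1, bl (h : H * H').2 z.2))
  (fun z g => (br z.1 (g : G * G').1, br z.2 (g : G * G').2)) _ _ _ _ _).
- by case=> x y; rewrite /= !bl1.
- by move=> h h' z; rewrite /= !blM.
- by case=> x y; rewrite /= !br1.
- by move=> z g g'; rewrite /= !brM.
- by move=> h z g; rewrite /= !blr.
Defined.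

(* An (H,G)-biset as an (H x G)-set, by (h,g)x = h x g^-1. *)
Definition bset_of H G (X : biset H G) : biset (H *g G) gone.
Proof.
refine (@Biset (H *g G) gone (bcar X) (bfinite X)
  (fun h x => br (bl (h : H * G).1 x) (h : H * G).2^-1%g)
  (fun x _ => x) _ _ _ _ _) => //=.
- by move=> x; rewrite bl1 invg1 br1.
- by move=> h h' x; rewrite invMg blM brM !blr.
Defined.

Section Tensor.
Variables (K H G : fgroup) (V : biset K H) (U : biset H G).

(* V x_H U is the set of orbits of V x U under (v,u) |-> (v h, h^-1 u); each
   orbit is represented by the element [trep] selects in it, which keeps the
   carrier in Set. *)
Definition torb (p q : V * U) :=
  [exists h : H, q == (br p.1 h, bl h^-1%g p.2)].
Definition trep (p : V * U) : V * U := odflt p [pick q | torb p q].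

Fact torbxx p : torb p p.
Proof.
by apply/existsP; exists 1%g; rewrite br1 invg1 bl1 -surjective_pairing.
Qed.

Fact torb_sym p q : torb p q -> torb q p.
Proof.
case/existsP=> h /eqP ->; apply/existsP; exists h^-1%g => /=.
by rewrite -brM -blM mulgV br1 mulVg bl1 -surjective_pairing.
Qed.

Fact torb_trans p q r : torb p q -> torb q r -> torb p r.
Proof.
case/existsP=> h /eqP -> /existsP[h' /eqP ->]; apply/existsP.
by exists (h * h')%g; rewrite /= brM invMg blM.
Qed.

Fact torb_rep p : torb p (trep p).
Proof. by rewrite /trep; case: pickP => //= _; exact: torbxx. Qed.

Fact trepE p q : (trep p == trep q) = torb p q.
Proof.
apply/eqP/idP => [epq|pq].
  by apply: torb_trans (torb_rep p) _; rewrite epq; exact/torb_sym/torb_rep.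
have epq : torb p =1 torb q.
  move=> r; apply/idP/idP; apply: torb_trans => //.
  exact: torb_sym.
rewrite /trep (eq_pick epq); case: pickP => //= /(_ q).
by rewrite torbxx.
Qed.

Fact trep_torb p q : trep p = trep q -> torb p q.
Proof. by rewrite -trepE => ->; exact: eqxx. Qed.

Fact trepK p : trep (trep p) == trep p.
Proof. by rewrite trepE; exact/torb_sym/torb_rep. Qed.

Definition tcar : Set := {p : bcar V * bcar U | trep p == p}.
Definition tcls (p : V * U) : tcar := exist _ (trep p) (trepK p).

Fact tclsE p q : (tcls p = tcls q) <-> torb p q.
Proof.
rewrite -trepE; split=> [[->]|/eqP epq]; first exact: eqxx.
by apply: val_inj.
Qed.

Fact tcls_val x : tcls (val x) = x.
Proof. by apply: val_inj; exact: (eqP (valP x)). Qed.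

Definition tbl (k : K) (x : tcar) : tcar :=
  tcls (bl k (val x).1, (val x).2).
Definition tbr (x : tcar) (g : G) : tcar :=
  tcls ((val x).1, br (val x).2 g).

Fact tbl_cls k p : tbl k (tcls p) = tcls (bl k p.1, p.2).
Proof.
apply/tclsE/torb_sym; case/existsP: (torb_rep p) => h /eqP /= ->.
by apply/existsP; exists h => /=; rewrite blr.
Qed.

Fact tbr_cls p g : tbr (tcls p) g = tcls (p.1, br p.2 g).
Proof.
apply/tclsE/torb_sym; case/existsP: (torb_rep p) => h /eqP /= ->.
by apply/existsP; exists h => /=; rewrite blr.
Qed.

Definition btens : biset K G.
Proof.
refine (@Biset K G tcar (finite_finType {p : V * U | trep p == p}) tbl tbr
  _ _ _ _ _).
- by move=> x; rewrite -{2}(tcls_val x) /tbl bl1 -surjective_pairing.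
- by move=> h h' x; rewrite {3}/tbl tbl_cls /tbl /= blM.
- by move=> x; rewrite -{2}(tcls_val x) /tbr br1 -surjective_pairing.
- by move=> x g g'; rewrite {3}/tbr tbr_cls /tbr /= brM.
- by move=> h x g; rewrite [tbl h x]/tbl tbr_cls [tbr x g]/tbr tbl_cls.
Defined.

(* The universal property of V x_H U. *)
Lemma btens_iso (Z : biset K G) (F : V * U -> Z) :
    (forall p q, F p = F q <-> torb p q) -> (forall z, exists p, F p = z) ->
    (forall k p, F (bl k p.1, p.2) = bl k (F p)) ->
    (forall p g, F (p.1, br p.2 g) = br (F p) g) ->
  biso btens Z.
Proof.
move=> FE Fsurj Fl Fr.
have Fcls p : F (val (tcls p)) = F p by apply/FE/torb_sym/torb_rep.
exists (fun x : tcar => F (val x)); split.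
- have [G0 FG0] := choice Fsurj; exists (fun z => tcls (G0 z)) => [x|z].
    by rewrite -[RHS]tcls_val; apply/tclsE/FE; rewrite FG0.
  by rewrite Fcls FG0.
- by move=> h x; rewrite [bl h x]/(tbl h x) /tbl Fcls Fl.
- by move=> x g; rewrite [br x g]/(tbr x g) /tbr Fcls Fr.
Qed.

End Tensor.
End BisetConstructions.

Lemma btens_isor K H G (V : biset K H) (X Y : biset H G) :
  biso X Y -> biso (btens V X) (btens V Y).
Proof.
move=> [f [[f' fK f'K] fl fr]].
apply: (btens_iso (F := fun p => tcls (p.1, f p.2) : btens V Y)).
- move=> [v x] [v' x']; rewrite tclsE; split=> /existsP[h /eqP /= [-> e]].
    have -> : x' = bl h^-1%g x by apply: (can_inj fK); rewrite fl.
    by apply/existsP; exists h.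
  by apply/existsP; exists h; rewrite /= e fl.
- move=> z; exists ((val z).1, f' (val z).2) => /=.
  by rewrite f'K -surjective_pairing tcls_val.
- by move=> k [v x]; exact/esym/tbl_cls.
- by move=> [v x] g; rewrite /= fr; exact/esym/tbr_cls.
Qed.

Lemma btens_isol K H G (X Y : biset K H) (U : biset H G) :
  biso X Y -> biso (btens X U) (btens Y U).
Proof.
move=> [f [[f' fK f'K] fl fr]].
apply: (btens_iso (F := fun p => tcls (f p.1, p.2) : btens Y U)).
- move=> [x u] [x' u']; rewrite tclsE; split=> /existsP[h /eqP /= [e ->]].
    have -> : x' = br x h by apply: (can_inj fK); rewrite fr.
    by apply/existsP; exists h.
  by apply/existsP; exists h; rewrite /= e fr.
- move=> z; exists (f' (val z).1, (val z).2) => /=.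
  by rewrite f'K -surjective_pairing tcls_val.
- by move=> k [x u]; rewrite /= fl; exact/esym/tbl_cls.
- by move=> [x u] g; exact/esym/tbr_cls.
Qed.

Lemma btens_sumr K H G (V : biset K H) (X Y : biset H G) :
  biso (btens V (bsum X Y)) (bsum (btens V X) (btens V Y)).
Proof.
pose F (p : V * bsum X Y) : bsum (btens V X) (btens V Y) := match p.2 with
  | inl x => inl (tcls (p.1, x) : btens V X)
  | inr y => inr (tcls (p.1, y) : btens V Y) end.
apply: (btens_iso (F := F)); rewrite /F.
- move=> [v [x|y]] [v' [x'|y']] /=; split=> //.
  + move=> [e]; case/existsP: (trep_torb e) => h /eqP /= [-> ->].
    by apply/existsP; exists h.
  + case/existsP=> h /eqP /= [-> ->]; congr inl; apply/tclsE.
    by apply/existsP; exists h.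
  + by case/existsP=> h /eqP.
  + by case/existsP=> h /eqP.
  + move=> [e]; case/existsP: (trep_torb e) => h /eqP /= [-> ->].
    by apply/existsP; exists h.
  + case/existsP=> h /eqP /= [-> ->]; congr inr; apply/tclsE.
    by apply/existsP; exists h.
- case=> x; [exists ((val x).1, inl (val x).2)|
             exists ((val x).1, inr (val x).2)] => /=.
    by rewrite -surjective_pairing tcls_val.
  by rewrite -surjective_pairing tcls_val.
- by move=> k [v [x|y]] /=; congr (_ _); exact/esym/tbl_cls.
- by move=> [v [x|y]] g /=; congr (_ _); exact/esym/tbr_cls.
Qed.

Lemma btens_suml K H G (X Y : biset K H) (U : biset H G) :
  biso (btens (bsum X Y) U) (bsum (btens X U) (btens Y U)).
Proof.
pose F (p : bsum X Y * U) : bsum (btens X U) (btens Y U) := match p.1 with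
  | inl x => inl (tcls (x, p.2) : btens X U)
  | inr y => inr (tcls (y, p.2) : btens Y U) end.
apply: (btens_iso (F := F)); rewrite /F.
- move=> [[x|y] u] [[x'|y'] u'] /=; split=> //.
  + move=> [e]; case/existsP: (trep_torb e) => h /eqP /= [-> ->].
    by apply/existsP; exists h.
  + case/existsP=> h /eqP /= [-> ->]; congr inl; apply/tclsE.
    by apply/existsP; exists h.
  + by case/existsP=> h /eqP.
  + by case/existsP=> h /eqP.
  + move=> [e]; case/existsP: (trep_torb e) => h /eqP /= [-> ->].
    by apply/existsP; exists h.
  + case/existsP=> h /eqP /= [-> ->]; congr inr; apply/tclsE.
    by apply/existsP; exists h.
- case=> x; [exists (inl (val x).1, (val x).2)|
             exists (inr (val x).1, (val x).2)] => /=.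
    by rewrite -surjective_pairing tcls_val.
  by rewrite -surjective_pairing tcls_val.
- by move=> k [[x|y] u] /=; congr (_ _); exact/esym/tbl_cls.
- by move=> [[x|y] u] g /=; congr (_ _); exact/esym/tbr_cls.
Qed.

Lemma bprod_isol H G H' G' (X X' : biset H G) (Y : biset H' G') :
  biso X X' -> biso (bprod X Y) (bprod X' Y).
Proof.
move=> [f [[f' fK f'K] fl fr]].
exists (fun z => (f z.1, z.2) : bprod X' Y); split=> [|h z|z g] /=.
- by exists (fun z => (f' z.1, z.2)) => -[x y] /=; rewrite ?fK ?f'K.
- by rewrite fl.
- by rewrite fr.
Qed.

Lemma bprod_isor H G H' G' (X : biset H G) (Y Y' : biset H' G') :
  biso Y Y' -> biso (bprod X Y) (bprod X Y').
Proof.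
move=> [f [[f' fK f'K] fl fr]].
exists (fun z => (z.1, f z.2) : bprod X Y'); split=> [|h z|z g] /=.
- by exists (fun z => (z.1, f' z.2)) => -[x y] /=; rewrite ?fK ?f'K.
- by rewrite fl.
- by rewrite fr.
Qed.

Lemma bprod_suml H G H' G' (X X' : biset H G) (Y : biset H' G') :
  biso (bprod (bsum X X') Y) (bsum (bprod X Y) (bprod X' Y)).
Proof.
exists (fun z => match z.1 with
  | inl x => inl ((x, z.2) : bprod X Y)
  | inr x => inr ((x, z.2) : bprod X' Y) end
  : bsum (bprod X Y) (bprod X' Y)).
split=> [|h [[x|x] y]|[[x|x] y] g] //=.
exists (fun z => match z with inl p => (inl p.1, p.2) | inr p => (inr p.1, p.2)
  end : bprod (bsum X X') Y); first by case=> -[].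
by do 2!case.
Qed.

Lemma bprod_sumr H G H' G' (X : biset H G) (Y Y' : biset H' G') :
  biso (bprod X (bsum Y Y')) (bsum (bprod X Y) (bprod X Y')).
Proof.
exists (fun z => match z.2 with
  | inl y => inl ((z.1, y) : bprod X Y)
  | inr y => inr ((z.1, y) : bprod X Y') end
  : bsum (bprod X Y) (bprod X Y')).
split=> [|h [x [y|y]]|[x [y|y]] g] //=.
exists (fun z => match z with inl p => (p.1, inl p.2) | inr p => (p.1, inr p.2)
  end : bprod X (bsum Y Y')); first by case=> ? [].
by do 2!case.
Qed.

(** * The R-modules RB(H,G) *)

Section RB.
Variable R : comPzRingType.

Section RBdef.
Variables H G : fgroup.

Definition additive_on_bisets (M : lmodType R) (f : biset H G -> M) : Prop :=
  (forall X Y, biso X Y -> f X = f Y) /\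
  (forall X Y, f (bsum X Y) = f X + f Y).

Definition fsum (M : lmodType R) (f : biset H G -> M)
    (s : seq (R * biset H G)) : M :=
  \sum_(p <- s) p.1 *: f p.2.

(* R tensored with the Grothendieck group of finite (H,G)-bisets is the
   R-module generated by the bisets, with the relations X = Y for X, Y
   isomorphic and (X disjoint-union Y) = X + Y.  Two formal R-linear
   combinations are equal in it iff every map to an R-module that satisfies
   these relations takes the same value on both. *)
Definition RBrel (s t : seq (R * biset H G)) : bool :=
  `[< forall (M : lmodType R) (f : biset H G -> M),
        additive_on_bisets f -> fsum f s = fsum f t >].

Fact RBrel_equiv : equiv_class_of RBrel.
Proof.
split=> [s|s t|t s u].
- by apply/asboolP.
- by apply/asboolP/asboolP => st M f fA; rewrite st.
- by move=> /asboolP st /asboolP tu; apply/asboolP => M f fA; rewrite st // tu.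
Qed.
Canonical RBrel_rel := EquivRelPack RBrel_equiv.

Definition RB := {eq_quot RBrel}.
HB.instance Definition _ := Choice.on RB.

Definition RBpi (s : seq (R * biset H G)) : RB := \pi_RB s.

Fact RBpiP s t : RBpi s = RBpi t <->
  forall (M : lmodType R) (f : biset H G -> M),
    additive_on_bisets f -> fsum f s = fsum f t.
Proof.
split=> [/eqP|st]; first by rewrite eqmodE => /asboolP.
by apply/eqP; rewrite eqmodE; apply/asboolP.
Qed.

Definition RBadd (u v : RB) : RB := RBpi (repr u ++ repr v).
Definition RBscale (a : R) (u : RB) : RB :=
  RBpi [seq (a * p.1, p.2) | p <- repr u].

(* The linear map induced by an additive map on bisets; see RBlift_class. *)
Definition RBlift (M : lmodType R) (f : biset H G -> M) (u : RB) : M :=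
  fsum f (repr u).

Lemma RBlift_pi (M : lmodType R) (f : biset H G -> M) s :
  additive_on_bisets f -> RBlift f (RBpi s) = fsum f s.
Proof. by move=> fA; apply: (RBpiP _ _).1 => //; rewrite /RBpi reprK. Qed.

Lemma RBext u v : (forall (M : lmodType R) (f : biset H G -> M),
  additive_on_bisets f -> RBlift f u = RBlift f v) -> u = v.
Proof. by move=> uv; rewrite -[u]reprK -[v]reprK; apply/RBpiP. Qed.

Lemma fsum_scale (M : lmodType R) (f : biset H G -> M) a s :
  fsum f [seq (a * p.1, p.2) | p <- s] = a *: fsum f s.
Proof.
rewrite /fsum big_map scaler_sumr.
by apply: eq_bigr => p _; rewrite scalerA.
Qed.

Lemma RBlift_add (M : lmodType R) (f : biset H G -> M) u v :
  additive_on_bisets f -> RBlift f (RBadd u v) = RBlift f u + RBlift f v.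
Proof. by move=> fA; rewrite RBlift_pi // /fsum big_cat. Qed.

Lemma RBlift_scale (M : lmodType R) (f : biset H G -> M) a u :
  additive_on_bisets f -> RBlift f (RBscale a u) = a *: RBlift f u.
Proof. by move=> fA; rewrite RBlift_pi // fsum_scale. Qed.

Fact RBaddA : associative RBadd.
Proof. by move=> u v w; apply: RBext => M f fA; rewrite !RBlift_add // addrA. Qed.
Fact RBaddC : commutative RBadd.
Proof. by move=> u v; apply: RBext => M f fA; rewrite !RBlift_add // addrC. Qed.
Fact RBadd0 : left_id (RBpi [::]) RBadd.
Proof.
move=> u; apply: RBext => M f fA.
by rewrite RBlift_add // RBlift_pi // /fsum big_nil add0r.
Qed.
Fact RBaddN : left_inverse (RBpi [::]) (RBscale (-1)) RBadd.
Proof.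
move=> u; apply: RBext => M f fA.
by rewrite RBlift_add // RBlift_scale // RBlift_pi // /fsum big_nil scaleN1r addNr.
Qed.
HB.instance Definition _ :=
  GRing.isZmodule.Build RB RBaddA RBaddC RBadd0 RBaddN.

Fact RBscaleA a b u : RBscale a (RBscale b u) = RBscale (a * b) u.
Proof. by apply: RBext => M f fA; rewrite !RBlift_scale // scalerA. Qed.
Fact RBscale1 : left_id 1 RBscale.
Proof. by move=> u; apply: RBext => M f fA; rewrite RBlift_scale // scale1r. Qed.
Fact RBscaleDr : right_distributive RBscale +%R.
Proof.
move=> a u v; apply: RBext => M f fA.
by rewrite !(RBlift_scale, RBlift_add) // scalerDr.
Qed.
Fact RBscaleDl u : {morph RBscale^~ u : a b / a + b}.
Proof.
move=> a b; apply: RBext => M f fA.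
by rewrite !(RBlift_scale, RBlift_add) // scalerDl.
Qed.
HB.instance Definition _ := GRing.Zmodule_isLmodule.Build R RB
  RBscaleA RBscale1 RBscaleDr RBscaleDl.

Definition RBcls (X : biset H G) : RB := RBpi [:: (1, X)].

Lemma RBcls_additive : additive_on_bisets RBcls.
Proof.
split=> X Y; first move=> iXY; apply: RBext => M f [fI fD].
  by rewrite !RBlift_pi // /fsum !big_seq1 (fI _ _ iXY).
by rewrite RBlift_add // !RBlift_pi // /fsum !big_seq1 fD scalerDr.
Qed.

Lemma RBlift_class (M : lmodType R) (f : biset H G -> M) X :
  additive_on_bisets f -> RBlift f (RBcls X) = f X.
Proof. by move=> fA; rewrite RBlift_pi // /fsum big_seq1 scale1r. Qed.

Lemma RBlift_linear (M : lmodType R) (f : biset H G -> M) :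
  additive_on_bisets f -> linear (RBlift f).
Proof. by move=> fA a u v; rewrite RBlift_add // RBlift_scale. Qed.

Lemma RB_gen (u : RB) : u = \sum_(p <- repr u) p.1 *: RBcls p.2.
Proof.
rewrite -[LHS]reprK; elim: (repr u) => [|p s IHs]; first by rewrite big_nil.
rewrite big_cons -IHs; apply: RBext => M f fA.
rewrite RBlift_add // RBlift_scale // RBlift_class // !RBlift_pi //.
by rewrite /fsum big_cons.
Qed.

End RBdef.

Definition Ind (K G : fgroup) (f : {multiplicative K -> G}) : RB G K :=
  RBcls (bInd f).
Definition Res (K G : fgroup) (f : {multiplicative K -> G}) : RB K G :=
  RBcls (bRes f).
Definition RBid (G : fgroup) : RB G G := Ind (hid G).

(* Composition in RD, [V] o [U] = [V x_H U], and product of morphisms,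
   [X] x [Y] = [X x Y], extended bilinearly. *)
Definition RBcomp (K H G : fgroup) (v : RB K H) (u : RB H G) : RB K G :=
  RBlift (fun V => RBlift (fun U => RBcls (btens V U)) u) v.

Definition RBprod (H G H' G' : fgroup) (u : RB H G) (v : RB H' G') :
    RB (H *g H') (G *g G') :=
  RBlift (fun X => RBlift (fun Y => RBcls (bprod X Y)) v) u.

(* The identification of RB(H,G) with RB(H x G) = RB(H x G, 1). *)
Definition RBset (H G : fgroup) (u : RB H G) : RB (H *g G) gone :=
  RBlift (fun X => RBcls (bset_of X)) u.

Lemma RBlift2_class (K L H G H' G' : fgroup)
    (b : biset H G -> biset H' G' -> biset K L) X Y :
    (forall X X' Y, biso X X' -> biso (b X Y) (b X' Y)) ->
    (forall X Y Y', biso Y Y' -> biso (b X Y) (b X Y')) ->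
    (forall X X' Y, biso (b (bsum X X') Y) (bsum (b X Y) (b X' Y))) ->
    (forall X Y Y', biso (b X (bsum Y Y')) (bsum (b X Y) (b X Y'))) ->
  RBlift (fun X => RBlift (fun Y => RBcls (b X Y)) (RBcls Y)) (RBcls X)
    = RBcls (b X Y).
Proof.
move=> iX iY sX sY; have [cI cD] := @RBcls_additive K L.
have addr X' : additive_on_bisets (fun Y => RBcls (b X' Y)).
  by split=> Y1 Y2 => [/iY/cI|]; rewrite ?(cI _ _ (sY _ _ _)).
have addl : additive_on_bisets (fun X => RBlift (fun Y => RBcls (b X Y)) (RBcls Y)).
  by split=> X1 X2 => [i12|]; rewrite !RBlift_class // -?cD; apply: cI; auto.
by rewrite RBlift_class // RBlift_class.
Qed.

Lemma RBcomp_class (K H G : fgroup) (V : biset K H) (U : biset H G) :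
  RBcomp (RBcls V) (RBcls U) = RBcls (btens V U).
Proof.
by apply: RBlift2_class => *; [exact: btens_isol|exact: btens_isor
                              |exact: btens_suml|exact: btens_sumr].
Qed.

Lemma RBprod_class (H G H' G' : fgroup) (X : biset H G) (Y : biset H' G') :
  RBprod (RBcls X) (RBcls Y) = RBcls (bprod X Y).
Proof.
by apply: RBlift2_class => *; [exact: bprod_isol|exact: bprod_isor
                              |exact: bprod_suml|exact: bprod_sumr].
Qed.

Lemma RBset_class (H G : fgroup) (X : biset H G) :
  RBset (RBcls X) = RBcls (bset_of X).
Proof.
apply: RBlift_class; have [cI cD] := @RBcls_additive (H *g G) gone.
split=> X1 X2 => [[f [fb fl fr]]|]; rewrite -?cD; apply: cI.
  by exists f; split=> //= h x; rewrite fr fl.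
by exists id; split=> [|h []|[]] //; exists id.
Qed.

End RB.

(* The same two bisets under the names they have for a surjection or an
   isomorphism. *)
Notation Def f := (Ind _ f) (only parsing).
Notation Inf f := (Res _ f) (only parsing).
Notation Iso f := (Ind _ f) (only parsing).

(** * Biset functors and Green biset functors *)

Section Functors.
Variables (R : comPzRingType) (D : groupClass).

(* An R-linear functor from RD to R-modules: M on objects, act on morphisms;
   a morphism G -> H of RD is an element of RB(H,G). *)
Record is_biset_functor (M : obj D -> lmodType R)
    (act : forall H G : obj D, RB R H G -> M G -> M H) : Prop := {
  act_linear : forall (H G : obj D) (u : RB R H G), linear (act H G u);
  act_linear_mor : forall (H G : obj D) (a : M G),
    linear (fun u : RB R H G => act H G u a);
  act_id : forall (G : obj D) (a : M G), act G G (RBid R G) a = a;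
  act_comp : forall (K H G : obj D) (v : RB R K H) (u : RB R H G) (a : M G),
    act K G (RBcomp v u) a = act K H v (act H G u a)
}.

Record is_green_functor (M : obj D -> lmodType R)
    (act : forall H G : obj D, RB R H G -> M G -> M H)
    (mul : forall G H : obj D, M G -> M H -> M (G ** H))
    (eps : M oone) : Prop := {
  green_functor : is_biset_functor act;
  green_linearl : forall (G H : obj D) (b : M H),
    linear (fun a : M G => mul G H a b);
  green_linearr : forall (G H : obj D) (a : M G), linear (mul G H a);
  green_assoc : forall (G H K : obj D) (a : M G) (b : M H) (c : M K),
    act (G ** (H ** K)) (G ** H ** K) (Iso (hassoc G H K))
      (mul (G ** H) K (mul G H a b) c)
    = mul G (H ** K) a (mul H K b c);
  green_unitl : forall (G : obj D) (a : M G),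
    act G (oone ** G) (Iso (hunitl G)) (mul oone G eps a) = a;
  green_unitr : forall (G : obj D) (a : M G),
    act G (G ** oone) (Iso (hunitr G)) (mul G oone a eps) = a;
  green_act : forall (G H G' H' : obj D) (phi : RB R G' G) (psi : RB R H' H)
      (a : M G) (b : M H),
    act (G' ** H') (G ** H) (RBprod phi psi) (mul G H a b)
    = mul G' H' (act G' G phi a) (act H' H psi b)
}.

Record greenFunctor := GreenFunctor {
  gmod :> obj D -> lmodType R;
  gact : forall H G : obj D, RB R H G -> gmod G -> gmod H;
  gmul : forall G H : obj D, gmod G -> gmod H -> gmod (G ** H);
  geps : gmod oone;
  greenP : is_green_functor gact gmul geps
}.

(* The component at G of the morphism of Green functors from RB to A. *)
Definition upsilon (A : greenFunctor) (G : obj D) (w : RB R G gone) : A G :=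
  gact (G := oone) w (geps A).

(** * The category P_A *)

Section PA.
Variable A : greenFunctor.
Implicit Types G H K L : obj D.

(* Morphisms G -> H of P_A. *)
Definition phom G H : lmodType R := A (H ** G).

Definition oleft (G : fgroup) : RB R gone (G *g G) :=
  RBcomp (Def (hto1 G)) (Res R (hdiag G)).

(* The action of H x oleft G x K, with (HG)(GK) = H(GG)K and H1K = HK. *)
Definition pcomp H G K (beta : phom G H) (alpha : phom K G) : phom K H :=
  gact (H := H ** K) (G := (H ** G) ** (G ** K))
    (RBcomp (Iso (hdel1 H K))
       (RBcomp (RBprod (RBprod (RBid R H) (oleft G)) (RBid R K))
               (Iso (hmid H G G K))))
    (gmul beta alpha).

Definition pid G : phom G G :=
  gact (H := G ** G) (G := oone) (RBcomp (Ind R (hdiag G)) (Inf (hto1 G)))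
    (geps A).

(* alpha x L *)
Definition prho L G H (alpha : phom G H) : phom (G ** L) (H ** L) :=
  gact (H := (H ** L) ** (G ** L)) (G := H ** G)
    (RBcomp (Ind R (hrho H G L)) (Inf (hfst (H *g G) L))) alpha.

(* G x beta *)
Definition plam G L K (beta : A (L ** K)) : phom (G ** K) (G ** L) :=
  gact (H := (G ** L) ** (G ** K)) (G := L ** K)
    (RBcomp (Ind R (hlam G K L)) (Inf (hsnd G (L *g K)))) beta.

(** * The center *)

Definition is_natural L (t : forall G, phom G (G ** L)) : Prop :=
  forall G H (alpha : phom G H),
    pcomp (prho L alpha) (t G) = pcomp (t H) alpha.

Record center L := Center {
  ccomp :> forall G, phom G (G ** L);
  centerP : is_natural ccomp
}.

Lemma center_ext L (s t : center L) : (forall G, s G = t G) -> s = t.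
Proof.
case: s t => [s sN] [t tN] /= st.
have e : s = t by apply: functional_extensionality_dep.
by case: _ / e tN => tN; rewrite (Prop_irrelevance sN tN).
Qed.

Lemma gact_linear H G (u : RB R H G) : linear (gact (g := A) u).
Proof. exact: act_linear (green_functor (greenP A)) _ _ u. Qed.

Lemma pcomp_linearl H G K (alpha : phom K G) :
  linear (fun beta : phom G H => pcomp beta alpha).
Proof.
by move=> a x y; rewrite /pcomp (green_linearl (greenP A)) gact_linear.
Qed.

Lemma pcomp_linearr H G K (beta : phom G H) :
  linear (fun alpha : phom K G => pcomp beta alpha).
Proof.
by move=> a x y; rewrite /pcomp (green_linearr (greenP A)) gact_linear.
Qed.

Section CenterModule.
Variable L : obj D.

Fact linear_natural a (s t : center L) :
  is_natural (fun G => a *: s G + t G).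
Proof.
move=> G H alpha.
by rewrite pcomp_linearr pcomp_linearl !centerP.
Qed.

Definition center_lin a (s t : center L) : center L :=
  Center (linear_natural a s t).

Fact zero_natural : is_natural (fun G => 0 : phom G (G ** L)).
Proof.
have lin0 (M N : lmodType R) (f : M -> N) : linear f -> f 0 = 0.
  by move=> fl; have := fl (-1) 0 0; rewrite scaler0 addr0 scaleN1r addNr.
move=> G H alpha.
by rewrite (lin0 _ _ _ (pcomp_linearr _)) (lin0 _ _ _ (pcomp_linearl _)).
Qed.

Definition center0 : center L := Center zero_natural.
Definition center_add (s t : center L) : center L := center_lin 1 s t.
Definition center_scale a (s : center L) : center L := center_lin a s center0.
Definition center_opp (s : center L) : center L := center_scale (-1) s.

HB.instance Definition _ := gen_eqMixin (center L).
HB.instance Definition _ := gen_choiceMixin (center L).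

Fact center_addA : associative center_add.
Proof. by move=> s t u; apply: center_ext => G; rewrite /= !scale1r addrA. Qed.
Fact center_addC : commutative center_add.
Proof. by move=> s t; apply: center_ext => G; rewrite /= !scale1r addrC. Qed.
Fact center_add0 : left_id center0 center_add.
Proof. by move=> s; apply: center_ext => G; rewrite /= scale1r add0r. Qed.
Fact center_addN : left_inverse center0 center_opp center_add.
Proof.
by move=> s; apply: center_ext => G; rewrite /= scale1r addr0 scaleN1r addNr.
Qed.
HB.instance Definition _ := GRing.isZmodule.Build (center L)
  center_addA center_addC center_add0 center_addN.

Fact center_scaleA a b s :
  center_scale a (center_scale b s) = center_scale (a * b) s.
Proof. by apply: center_ext => G; rewrite /= !addr0 scalerA. Qed.
Fact center_scale1 : left_id 1 center_scale.
Proof. by move=> s; apply: center_ext => G; rewrite /= addr0 scale1r. Qed.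
Fact center_scaleDr : right_distributive center_scale +%R.
Proof.
by move=> a s t; apply: center_ext => G; rewrite /= !addr0 !scale1r scalerDr.
Qed.
Fact center_scaleDl s : {morph center_scale^~ s : a b / a + b}.
Proof.
by move=> a b; apply: center_ext => G; rewrite /= !addr0 !scale1r scalerDl.
Qed.
HB.instance Definition _ := GRing.Zmodule_isLmodule.Build R (center L)
  center_scaleA center_scale1 center_scaleDr center_scaleDl.

End CenterModule.

Definition ZA L : lmodType R := center L.

(* The element u_A of A(LK). *)
Definition image_in L K (u : RB R L K) : A (L ** K) :=
  upsilon A (G := L ** K) (RBset u).

(* The components of rho_{u_A} o t. *)
Definition center_act L K (u : RB R L K) (t : ZA K) G : phom G (G ** L) :=
  pcomp (plam G (image_in u)) (t G).

(* The components of s^o. *)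
Definition center_op K (s : ZA K) G : phom (G ** K) G :=
  gact (H := G ** (G ** K)) (G := G ** K ** G) (Iso (hswap G G K)) (s G).

(* The components of ^o(t o s^o). *)
Definition center_mul L K (t : ZA L) (s : ZA K) G : phom G (G ** (L ** K)) :=
  gact (H := G ** (L ** K) ** G) (G := (G ** L) ** (G ** K))
    (Iso (htransp G G K L)) (pcomp (t G) (center_op s G)).

(* The components of the identity of Id = rho_1, with G = G1. *)
Definition center_one G : phom G (G ** oone) :=
  gact (H := G ** oone ** G) (G := G ** G) (Iso (hins1 G G)) (pid G).

End PA.
End Functors.

(* Main.v *)
(** A transitive (H,G)-biset is determined by the stabiliser of a point, a
    subgroup of H x G, read here as a relation between H and G.  By the Mackey
    formula a tensor product of two transitive bisets is again transitive, with
    the composite relation as stabiliser, as soon as the two relations jointly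
    cover the middle group.  All structural bisets are of this kind, and
    transitive bisets span RB(H,G); so an identity between expressions built
    from the action, the products and the composition of P_A reduces, by
    bringing both sides to the form u (a x b x c), to an equivalence of two
    explicit relations.

    In this way ZA(u)(t)_G = (G x u x G) t_G, and the product of two families
    is the component at (t_G, s_G) of an operation A(HLG) x A(GKG') ->
    A(HLKG'), whose compatibility with the composition of P_A on the left, in
    the middle and on the right turns naturality of t and s into naturality of
    the product. *)
Require Import Defs.
From HB Require Import structures.
From mathcomp Require Import all_boot all_order all_algebra all_fingroup.
From mathcomp Require Import generic_quotient boolp.
(* [gact] must be that of [Defs], not the group action of [fingroup]. *)
Import Defs.

Set Implicit Arguments.
Unset Strict Implicit.
Unset Printing Implicit Defensive.

Import GRing.Theory.
Local Open Scope ring_scope.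

(** * Transitive bisets and their stabilisers *)

(* [S] is the stabiliser of a point for the action (h,g)x = h x g^-1. *)
Definition has_stab (H G : fgroup) (X : biset H G) (S : H -> G -> Prop) :=
  exists x0 : bcar X,
    (forall x, exists h g, x = br (bl h x0) g) /\
    (forall h g, bl h x0 = br x0 g <-> S h g).

Lemma blK (H G : fgroup) (X : biset H G) (h : H) (x : bcar X) :
  bl h^-1%g (bl h x) = x.
Proof. by rewrite -blM mulVg bl1. Qed.

Lemma blVK (H G : fgroup) (X : biset H G) (h : H) (x : bcar X) :
  bl h (bl h^-1%g x) = x.
Proof. by rewrite -blM mulgV bl1. Qed.

Lemma brK (H G : fgroup) (X : biset H G) (g : G) (x : bcar X) :
  br (br x g) g^-1%g = x.
Proof. by rewrite -brM mulgV br1. Qed.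

Lemma brVK (H G : fgroup) (X : biset H G) (g : G) (x : bcar X) :
  br (br x g^-1%g) g = x.
Proof. by rewrite -brM mulVg br1. Qed.

Section StabTheory.
Variables (H G : fgroup) (X : biset H G) (S : H -> G -> Prop).
Hypothesis stabS : has_stab X S.

Lemma stab1 : S 1%g 1%g.
Proof. by case: stabS => x0 [_ SE]; apply/SE; rewrite bl1 br1. Qed.

Lemma stab_ext (T : H -> G -> Prop) :
  (forall h g, S h g <-> T h g) -> has_stab X T.
Proof.
by move=> ST; case: stabS => x0 [tr SE]; exists x0; split=> // h g; rewrite SE.
Qed.

(** Whether the points [h x0 g] and [h' x0 g'] agree depends on [S] alone, so sending [h x0 g] to
    [h y0 g] is well defined and injective. *)
Lemma stab_biso (Y : biset H G) : has_stab Y S -> biso X Y.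
Proof.
case: stabS => x0 [trX Sx] [y0 [trY Sy]].
have E h g h' g' : br (bl h x0) g = br (bl h' x0) g' <->
    br (bl h y0) g = br (bl h' y0) g'.
  have aux (Z : biset H G) (z : bcar Z) : br (bl h z) g = br (bl h' z) g' <->
      bl (h'^-1 * h)%g z = br z (g' * g^-1)%g.
    rewrite blM brM; split=> [/(congr1 (fun x => bl h'^-1%g (br x g^-1%g)))|e].
      by rewrite brK -!blr blK.
    by rewrite -[bl h z](blVK h') e blr brVK blr.
  by rewrite !aux Sx Sy.
have /choice[f fP] x : exists y : bcar Y, exists h g,
    x = br (bl h x0) g /\ y = br (bl h y0) g.
  by have [h [g ->]] := trX x; exists (br (bl h y0) g), h, g.
have /choice[f' f'P] y : exists x : bcar X, exists h g,
    y = br (bl h y0) g /\ x = br (bl h x0) g.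
  by have [h [g ->]] := trY y; exists (br (bl h x0) g), h, g.
have fE h g : f (br (bl h x0) g) = br (bl h y0) g.
  by have [h' [g' [/E e ->]]] := fP (br (bl h x0) g).
have f'E h g : f' (br (bl h y0) g) = br (bl h x0) g.
  by have [h' [g' [/E e ->]]] := f'P (br (bl h y0) g).
exists f; split.
- exists f' => [x|y]; first by have [h [g ->]] := trX x; rewrite fE f'E.
  by have [h [g ->]] := trY y; rewrite f'E fE.
- move=> k x; have [h [g ->]] := trX x.
  by rewrite fE -!blr -!blM; rewrite fE.
- move=> x k; have [h [g ->]] := trX x.
  by rewrite fE -!brM fE.
Qed.

End StabTheory.

Lemma mul_hom1 (K G : fgroup) (f : {multiplicative K -> G}) : f 1%g = 1%g.
Proof. by apply: (mulgI (f 1%g)); rewrite -gmulfM !mulg1. Qed.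

Lemma stab_Ind (K G : fgroup) (f : {multiplicative K -> G}) :
  has_stab (bInd f) (fun g k => g = f k).
Proof.
exists (1%g : G); split=> [x|h g] /=; last by rewrite (@mulg1 G) (@mul1g G).
by exists (x : G), 1%g; rewrite mul_hom1 !(@mulg1 G).
Qed.

Lemma stab_Res (K G : fgroup) (f : {multiplicative K -> G}) :
  has_stab (bRes f) (fun k g => g = f k).
Proof.
exists (1%g : G); split=> [x|h g] /=.
  by exists 1%g, (x : G); rewrite mul_hom1 !(@mul1g G).
by rewrite (@mulg1 G) (@mul1g G); split=> ->.
Qed.

(** * Tensor products and products of transitive bisets *)

Definition rcomp (A B C : Type) (S : A -> B -> Prop) (T : B -> C -> Prop) :=
  fun a c => exists b, S a b /\ T b c.

(* The double cosets in the Mackey formula reduce to one. *)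
Definition mackey_cover (K H G : fgroup) (S : K -> H -> Prop)
    (T : H -> G -> Prop) :=
  forall h, exists s t k g, [/\ h = (s * t)%g, S k s & T t g].

Lemma btens_bl (K H G : fgroup) (X : biset K H) (Y : biset H G) k x y :
  bl k (tcls (x, y) : bcar (btens X Y)) = tcls (bl k x, y) :> bcar (btens X Y).
Proof. exact: tbl_cls. Qed.

Lemma btens_br (K H G : fgroup) (X : biset K H) (Y : biset H G) x y g :
  br (tcls (x, y) : bcar (btens X Y)) g = tcls (x, br y g) :> bcar (btens X Y).
Proof. exact: tbr_cls. Qed.

Lemma stab_tens (K H G : fgroup) (X : biset K H) (Y : biset H G) S T :
  has_stab X S -> has_stab Y T -> mackey_cover S T ->
  has_stab (btens X Y) (rcomp S T).
Proof.
move=> [x0 [trX SE]] [y0 [trY TE]] cST.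
exists (tcls (x0, y0)); split=> [z|k g].
  rewrite -[z]tcls_val; case: (val z) => x y {z}.
  have [k [h ->]] := trX x; have [h' [g ->]] := trY y.
  (* With [h * h' = s * t], the factor [s] passes to the left of [x0] as [k'] and [t] to the right
     of [y0] as [g']; the element moved across the tensor sign is [h^-1 * s]. *)
  have [s [t [k' [g' [e /SE Sk /TE Tg]]]]] := cST (h * h')%g.
  exists (k * k')%g, (g' * g)%g.
  rewrite btens_bl btens_br; apply/tclsE/existsP.
  exists (s^-1 * h)%g^-1%g; apply/eqP; rewrite /= invgK.
  have -> : h' = (h^-1 * (s * t))%g by rewrite -e mulKg.
  rewrite invMg invgK -brM mulKVg blM Sk blr; congr pair.
  by rewrite brM -Tg -!blr -!blM -mulgA mulKVg mulKg.
rewrite btens_bl btens_br tclsE.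
split=> [/existsP[h /eqP /= [e1 e2]]|[h [/SE e1 /TE e2]]].
  exists h^-1%g; split; last exact/TE/esym.
  by apply/SE; rewrite [in RHS]e1 brK.
by apply/existsP; exists h^-1%g; rewrite /= e1 invgK brK e2.
Qed.

Lemma stab_prod (H G H' G' : fgroup) (X : biset H G) (Y : biset H' G') S T :
  has_stab X S -> has_stab Y T ->
  has_stab (bprod X Y)
    (fun (h : H *g H') (g : G *g G') => S h.1 g.1 /\ T h.2 g.2).
Proof.
move=> [x0 [trX SE]] [y0 [trY TE]].
exists (x0, y0); split=> [[x y]|[h h'] [g g']] /=.
  have [h [g ->]] := trX x; have [h' [g' ->]] := trY y.
  by exists (h, h'), (g, g').
by rewrite -SE -TE; split=> [[-> ->]|[-> ->]].
Qed.

Lemma stab_set (H G : fgroup) (X : biset H G) S :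
  has_stab X S -> has_stab (bset_of X) (fun (x : H *g G) _ => S x.1 x.2).
Proof.
move=> [x0 [trX SE]]; exists x0; split=> [x|[h g] u] /=.
  have [h [g ->]] := trX x; exists (h, g^-1%g), tt.
  by rewrite /= invgK.
by rewrite -SE; split=> [{2}<-|->]; rewrite ?brVK ?brK.
Qed.

(** * Decomposition of bisets into orbits *)

Section SubBiset.
Variables (H G : fgroup) (X : biset H G) (P : pred (bcar X)).
Hypothesis Pl : forall h x, P x -> P (bl h x).
Hypothesis Pr : forall g x, P x -> P (br x g).

Let car : Set := {x : bcar X | P x}.

Definition bsub : biset H G.
Proof.
refine (@Biset H G car (finite_finType {x : X | P x})
  (fun h x => exist P _ (Pl h (valP x)))
  (fun x g => exist P _ (Pr g (valP x))) _ _ _ _ _).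
- by move=> x; apply: val_inj; rewrite /= bl1.
- by move=> h h' x; apply: val_inj; rewrite /= blM.
- by move=> x; apply: val_inj; rewrite /= br1.
- by move=> x g g'; apply: val_inj; rewrite /= brM.
- by move=> h x g; apply: val_inj; rewrite /= blr.
Defined.

End SubBiset.

Definition cls (R : comPzRingType) (H G : fgroup) (u : RB R H G)
    (S : H -> G -> Prop) : Prop :=
  exists2 X, u = RBcls R X & has_stab X S.

Section Orbits.
Variables (R : comPzRingType) (H G : fgroup).

Lemma bsub_split (X : biset H G) (P N : pred (bcar X))
    (NE : forall x, N x = ~~ P x)
    (Pl : forall h x, P x -> P (bl h x)) (Pr : forall g x, P x -> P (br x g))
    (Nl : forall h x, N x -> N (bl h x))
    (Nr : forall g x, N x -> N (br x g)) :
  biso X (bsum (bsub Pl Pr) (bsub Nl Nr)).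
Proof.
have d x : {P x} + {N x} by rewrite NE; case: (P x); [left|right].
pose f (x : bcar X) : bcar (bsum (bsub Pl Pr) (bsub Nl Nr)) :=
  match d x with
  | left p => inl (exist P x p)
  | right p => inr (exist N x p)
  end.
pose f' (z : bcar (bsum (bsub Pl Pr) (bsub Nl Nr))) : bcar X :=
  match z with inl x => val x | inr x => val x end.
have fK : cancel f f' by move=> x; rewrite /f; case: (d x).
have f'K : cancel f' f.
  case=> -[x Px] /=; rewrite /f; case: (d x) => p /=.
  - by congr inl; apply: val_inj.
  - by case/negP: (etrans (esym (NE x)) p).
  - by case/negP: (etrans (esym (NE x)) Px).
  - by congr inr; apply: val_inj.
exists f; split=> [|h x|x g]; first by exists f'.
  by apply: (can_inj f'K); rewrite fK -{1}(fK x); case: (f x).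
by apply: (can_inj f'K); rewrite fK -{1}(fK x); case: (f x).
Qed.

(** Induction on the cardinality of a biset: the orbit of a point is transitive and its complement
    is smaller. *)
Lemma RB_trans_ind (P : RB R H G -> Prop) :
    P 0 -> (forall a u v, P u -> P v -> P (a *: u + v)) ->
    (forall u S, cls u S -> P u) -> forall u, P u.
Proof.
move=> P0 PD Pcls u; rewrite (RB_gen u).
suff PC (X : biset H G) : P (RBcls R X).
  by apply: (big_ind P) => // [v w Pv Pw|p _];
     [rewrite -[v]scale1r|rewrite -[_ *: _]addr0]; exact: PD.
have [cI cD] := @RBcls_additive R H G.
have [n] := ubnP #|X|; elim: n X => // n IHn X /ltnSE-leXn.
have [x0 _|X0] := pickP X; last first.
  suff -> : RBcls R X = 0 by [].
  (* An empty [X] is isomorphic to the sum of two copies of itself, so its class is zero. *)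
  apply: (addrI (RBcls R X)); rewrite addr0 -cD; apply/esym/cI.
  exists (fun x => inl x : bcar (bsum X X)); split=> //.
  have F (x : bcar X) : False by have := X0 x.
  by exists (fun z => match z with inl x => x | inr x => x end) => [x|[]x];
    case: (F x).
pose orb (x : X) :=
  [exists h : H, exists g : G, x == br (bl h (x0 : bcar X)) g].
have Pl h x : orb x -> orb (bl h x).
  case/existsP=> h' /existsP[g /eqP ->]; apply/existsP; exists (h * h')%g.
  by apply/existsP; exists g; rewrite blM !blr.
have Pr g x : orb x -> orb (br x g).
  case/existsP=> h' /existsP[g' /eqP ->]; apply/existsP; exists h'.
  by apply/existsP; exists (g' * g)%g; rewrite brM.
pose compl (x : bcar X) := ~~ orb x.
have Nl h x : compl x -> compl (bl h x).
  by apply: contra => /(Pl h^-1%g); rewrite blK.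
have Nr g x : compl x -> compl (br x g).
  by apply: contra => /(Pr g^-1%g); rewrite brK.
have -> : RBcls R X = 1 *: RBcls R (bsub Pl Pr) + RBcls R (bsub Nl Nr).
  by rewrite scale1r -cD; apply: cI; exact: bsub_split.
have Px0 : orb x0.
  by apply/existsP; exists 1%g; apply/existsP; exists 1%g; rewrite bl1 br1.
apply: PD; last first.
  apply: IHn; apply: leq_trans leXn.
  pose f (y : bsub Nl Nr) : X := val (y : {x | compl x}).
  have fI : injective f by move=> y z /val_inj.
  (* The inclusion of the complement misses [x0], which gives the strict decrease. *)
  rewrite -(card_codom fI); apply/proper_card/properP.
  split; first exact/subsetP.
  exists x0 => //; apply/codomP => -[[y Ny] /= e].
  by case/negP: (Ny); rewrite (_ : y = x0).
apply: (Pcls _ (fun h g => bl h (x0 : bcar X) = br (x0 : bcar X) g)).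
exists (bsub Pl Pr) => //; exists (exist _ (x0 : bcar X) Px0).
split=> [[x Px]|h g] /=.
  have /existsP[h /existsP[g /eqP e]] := Px.
  by exists h, g; apply: val_inj.
by split=> [[]|e] //; apply: val_inj.
Qed.

End Orbits.

(** * Bilinearity and interchange *)

Section Interchange.
Variable R : comPzRingType.

Lemma btens_bprod (K H G K' H' G' : fgroup) (V : biset K H) (U : biset H G)
    (V' : biset K' H') (U' : biset H' G') :
  biso (btens (bprod V V') (bprod U U')) (bprod (btens V U) (btens V' U')).
Proof.
pose F (p : bprod V V' * bprod U U') : bprod (btens V U) (btens V' U') :=
  (tcls (p.1.1, p.2.1), tcls (p.1.2, p.2.2)).
apply: (btens_iso (F := F)); rewrite /F.
- move=> [[v v'] [u u']] [[w w'] [z z']] /=; split=> [[e e']|].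
    case/existsP: (trep_torb e) => h /eqP /= [-> ->].
    case/existsP: (trep_torb e') => h' /eqP /= [-> ->].
    by apply/existsP; exists (h, h').
  case/existsP=> [[h h']] /eqP /= [-> -> -> ->].
  by congr pair; apply/tclsE/existsP; [exists h|exists h'].
- move=> [x x']; exists (((val x).1, (val x').1), ((val x).2, (val x').2)).
  by rewrite /= -!surjective_pairing !tcls_val.
- by move=> [k k'] [[v v'] [u u']] /=; congr pair; exact/esym/btens_bl.
- by move=> [[v v'] [u u']] [g g'] /=; congr pair; exact/esym/btens_br.
Qed.

Section Bilinear.
Variables (K L H G H' G' : fgroup).
Variable b : biset H G -> biset H' G' -> biset K L.
Hypotheses (iX : forall X X' Y, biso X X' -> biso (b X Y) (b X' Y))
  (iY : forall X Y Y', biso Y Y' -> biso (b X Y) (b X Y'))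
  (sX : forall X X' Y, biso (b (bsum X X') Y) (bsum (b X Y) (b X' Y)))
  (sY : forall X Y Y', biso (b X (bsum Y Y')) (bsum (b X Y) (b X Y'))).

Let lift2 (u : RB R H G) (v : RB R H' G') : RB R K L :=
  RBlift (fun X => RBlift (fun Y => RBcls R (b X Y)) v) u.

Let addr X : additive_on_bisets (fun Y => RBcls R (b X Y)).
Proof.
have [cI cD] := @RBcls_additive R K L.
by split=> Y1 Y2 => [/iY/cI|]; rewrite ?(cI _ _ (sY _ _ _)).
Qed.

(** The outer lift is a fixed finite sum over a representative of [u], so linearity of each inner
    lift suffices. *)
Lemma RBlift2_linearr u : linear (lift2 u).
Proof.
move=> a v w; rewrite /lift2 /RBlift /fsum scaler_sumr -big_split /=.
apply: eq_bigr => p _; rewrite scalerA mulrC -scalerA -scalerDr.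
by congr (_ *: _); exact: (RBlift_linear (addr p.2)).
Qed.

Lemma RBlift2_linearl v : linear (lift2^~ v).
Proof.
have [cI cD] := @RBcls_additive R K L.
move=> a u w; apply: RBlift_linear; split=> X Y.
  move=> i; rewrite /RBlift /fsum; apply: eq_bigr => p _.
  by congr (_ *: _); apply: cI; apply: iX.
rewrite /RBlift /fsum -big_split /=; apply: eq_bigr => p _.
by rewrite -scalerDr -cD; congr (_ *: _); apply: cI.
Qed.

End Bilinear.

Lemma RBcomp_linearl (K H G : fgroup) (u : RB R H G) :
  linear (fun v : RB R K H => RBcomp v u).
Proof.
by apply: RBlift2_linearl => *; [exact: btens_isol|exact: btens_suml].
Qed.

Lemma RBcomp_linearr (K H G : fgroup) (v : RB R K H) :
  linear (fun u : RB R H G => RBcomp v u).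
Proof.
by apply: RBlift2_linearr => *; [exact: btens_isor|exact: btens_sumr].
Qed.

Lemma RBprod_linearl (H G H' G' : fgroup) (u : RB R H' G') :
  linear (fun v : RB R H G => RBprod v u).
Proof.
by apply: RBlift2_linearl => *; [exact: bprod_isol|exact: bprod_suml].
Qed.

Lemma RBprod_linearr (H G H' G' : fgroup) (v : RB R H G) :
  linear (fun u : RB R H' G' => RBprod v u).
Proof.
by apply: RBlift2_linearr => *; [exact: bprod_isor|exact: bprod_sumr].
Qed.

Lemma RBset_linear (H G : fgroup) : linear (@RBset R H G).
Proof.
apply: RBlift_linear; have [cI cD] := @RBcls_additive R (H *g G) gone.
split=> X1 X2 => [[f [fb fl fr]]|]; rewrite -?cD; apply: cI.
  by exists f; split=> //= h x; rewrite fr fl.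
by exists id; split=> [|h []|[]] //; exists id.
Qed.

End Interchange.

(** * Classes of transitive bisets in [RB] *)

Definition total_cover (A B C : Type) (S : A -> B -> Prop)
    (T : B -> C -> Prop) :=
  (forall b, exists a, S a b) \/ (forall b, exists c, T b c).

Section Classes.
Variable R : comPzRingType.

Section One.
Variables (H G : fgroup) (u : RB R H G) (S : H -> G -> Prop).
Hypothesis clsu : cls u S.

Lemma cls1 : S 1%g 1%g.
Proof. by case: clsu => X _ /stab1. Qed.

Lemma cls_ext (T : H -> G -> Prop) :
  (forall h g, T h g <-> S h g) -> cls u T.
Proof.
move=> ST; case: clsu => X -> sX; exists X => //.
by apply: (stab_ext sX) => h g; split=> /ST.
Qed.

Lemma cls_uniq v : cls v S -> u = v.
Proof.
case: clsu => X -> sX [Y -> sY].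
by apply: (@RBcls_additive R H G).1; exact: stab_biso sX _ sY.
Qed.

End One.

Lemma cls_Ind (K G : fgroup) (f : {multiplicative K -> G}) :
  cls (Ind R f) (fun g k => g = f k).
Proof. by exists (bInd f) => //; exact: stab_Ind. Qed.

Lemma cls_Res (K G : fgroup) (f : {multiplicative K -> G}) :
  cls (Res R f) (fun k g => g = f k).
Proof. by exists (bRes f) => //; exact: stab_Res. Qed.

Lemma cls_id (G : fgroup) : cls (RBid R G) (fun g k => g = k).
Proof. exact: cls_Ind. Qed.

Lemma cls_comp (K H G : fgroup) (v : RB R K H) (u : RB R H G) S T :
  cls v S -> cls u T -> mackey_cover S T -> cls (RBcomp v u) (rcomp S T).
Proof.
move=> [X -> sX] [Y -> sY] c; exists (btens X Y); first exact: RBcomp_class.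
exact: stab_tens.
Qed.

(** Both relations hold at the pair of identities, so a middle element factors as [h * 1] or
    [1 * h], according to the side that covers. *)
Lemma cls_comp_full (K H G : fgroup) (v : RB R K H) (u : RB R H G) S T :
  cls v S -> cls u T -> total_cover S T -> cls (RBcomp v u) (rcomp S T).
Proof.
move=> cv cu F; apply: cls_comp => // h; case: F => /(_ h) [k].
  by exists h, 1%g, k, 1%g; rewrite mulg1; split=> //; exact: cls1 cu.
by exists 1%g, h, 1%g, k; rewrite mul1g; split=> //; exact: cls1 cv.
Qed.

Lemma cls_prod (H G H' G' : fgroup) (u : RB R H G) (v : RB R H' G') S T :
  cls u S -> cls v T ->
  cls (RBprod u v)
    (fun (h : H *g H') (g : G *g G') => S h.1 g.1 /\ T h.2 g.2).
Proof.
by move=> [X -> sX] [Y -> sY]; exists (bprod X Y);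
  [exact: RBprod_class|exact: stab_prod].
Qed.

Lemma cls_set (H G : fgroup) (u : RB R H G) S :
  cls u S -> cls (RBset u) (fun (x : H *g G) _ => S x.1 x.2).
Proof.
by move=> [X -> sX]; exists (bset_of X); [exact: RBset_class|exact: stab_set].
Qed.

Lemma RB_linear_eq (H G : fgroup) (M : lmodType R) (f g : RB R H G -> M) :
    linear f -> linear g -> (forall u S, cls u S -> f u = g u) ->
  forall u, f u = g u.
Proof.
move=> fl gl fg; have lin0 (k : RB R H G -> M) : linear k -> k 0 = 0.
  by move=> kl; have := kl (-1) 0 0; rewrite scaler0 addr0 scaleN1r addNr.
apply: RB_trans_ind => // [|a u v fgu fgv]; first by rewrite !lin0.
by rewrite fl gl fgu fgv.
Qed.

(** All four arguments enter linearly, so classes of bisets suffice; there the identity is the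
    bijection of [btens_bprod] read backwards. *)
Lemma RBprod_comp (K H G K' H' G' : fgroup) (v : RB R K H) (u : RB R H G)
    (v' : RB R K' H') (u' : RB R H' G') :
  RBprod (RBcomp v u) (RBcomp v' u') = RBcomp (RBprod v v') (RBprod u u').
Proof.
have E := (@RBcomp_linearl R, @RBcomp_linearr R,
           @RBprod_linearl R, @RBprod_linearr R).
move: v; apply: RB_linear_eq => [a x y|a x y|_ _ [V -> _]]; rewrite ?E //.
move: u; apply: RB_linear_eq => [a x y|a x y|_ _ [U -> _]]; rewrite ?E //.
move: v'; apply: RB_linear_eq => [a x y|a x y|_ _ [V' -> _]]; rewrite ?E //.
move: u'; apply: RB_linear_eq => [a x y|a x y|_ _ [U' -> _]]; rewrite ?E //.
rewrite !(RBcomp_class, RBprod_class).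
apply: (@RBcls_additive R _ _).1.
have [f [[f' fK f'K] fl fr]] := btens_bprod V U V' U'.
exists f'; split; first by exists f.
  by move=> h x; apply: (can_inj fK); rewrite fl !f'K.
by move=> x h; apply: (can_inj fK); rewrite fr !f'K.
Qed.

End Classes.

(** * Tactics for explicit relations *)

(** Splitting an existential over a product gives each component its own unification variable. *)
Lemma ex_pair (A B : Type) (P : A * B -> Prop) :
  (exists a b, P (a, b)) -> exists x, P x.
Proof. by move=> [a [b Pab]]; exists (a, b). Qed.

Ltac split_pair x :=
  let T := type of x in
  let T' := eval hnf in T in
  match T' with
  | prod _ _ => let a := fresh x in let b := fresh x in
      destruct x as [a b]; split_pair a; split_pair b
  | unit => destruct x
  | _ => idtac
  end.

Ltac rel_intro :=
  repeat match goal with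
  | |- forall x : _, _ => let x := fresh "x" in intro x;
      first [split_pair x | idtac]
  end.

Ltac rel_hyps :=
  cbn in *; repeat (match goal with
  | H : _ /\ _ |- _ => destruct H
  | H : and3 _ _ _ |- _ => destruct H
  | H : exists x : _, _ |- _ =>
      let x := fresh "x" in destruct H as [x H]; split_pair x
  | H : (_, _) = (_, _) |- _ => injection H; clear H; intros
  | H : rcomp _ _ _ _ |- _ => unfold rcomp in H
  end; cbn in * ); subst.

Ltac rel_goal :=
  cbn;
  match goal with
  | |- _ /\ _ => split; rel_goal
  | |- and3 _ _ _ => split; rel_goal
  | |- rcomp _ _ _ _ => unfold rcomp; rel_goal
  | |- @ex ?T _ =>
      let T' := eval hnf in T in
      match T' with
      | prod _ _ => apply: ex_pair; rel_goal
      | unit => exists tt; rel_goal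
      | _ => eexists; rel_goal
      end
  | |- _ => first [reflexivity | eassumption | idtac]
  end.

(* Decides equivalences between relations given by equations between
   components of tuples. *)
Ltac rel :=
  rel_intro;
  first [split; intros; rel_hyps; rel_goal | rel_hyps; rel_goal].

(* These let unification recover the object from its underlying group. *)
#[local] Canonical oprod.
#[local] Canonical oone.

(** A pair typed in the product group, not in the bare product type; the bidirectionality hint
    passes the expected group to the components. *)
Definition gpair (M N : fgroup) (m : M) (n : N) : M *g N := (m, n).
Arguments gpair {M N} & m n.

(** * Elements of a Green functor up to transitive bisets *)

Section Wiring.
Variables (R : comPzRingType) (D : groupClass) (A : greenFunctor R D).
Implicit Types G H J K L : obj D.

(** A normal form for elements of [A]: by [wired_uniq], the relation [S] and the element [a]
    determine [x]. *)
Definition wired H G (x : A H) (S : H -> G -> Prop) (a : A G) : Prop :=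
  exists2 u : RB R H G, cls u S & x = gact u a.

Lemma gactC K H G (v : RB R K H) (u : RB R H G) (a : A G) :
  gact (RBcomp v u) a = gact v (gact u a).
Proof. exact: act_comp (green_functor (greenP A)) _ _ _ _ _ _. Qed.

Lemma wired_cls H G (u : RB R H G) S (a : A G) :
  cls u S -> wired (gact u a) S a.
Proof. by exists u. Qed.

Lemma wired_id H (x : A H) : wired x (fun y z => y = z) x.
Proof.
exists (RBid R H); first exact: cls_id.
by rewrite (act_id (green_functor (greenP A))).
Qed.

Lemma wired_uniq H G (x y : A H) S T (a : A G) :
  wired x S a -> wired y T a -> (forall h g, S h g <-> T h g) -> x = y.
Proof.
move=> [u cu ->] [v cv ->] ST; congr (gact _ _); apply: (cls_uniq cu).
exact: (cls_ext cv).
Qed.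

Lemma wired_ext H G (x : A H) S T (a : A G) :
  wired x S a -> (forall h g, T h g <-> S h g) -> wired x T a.
Proof. by move=> [u cu ->] ST; exists u => //; exact: (cls_ext cu). Qed.

Lemma wired_act K H G (u : RB R K H) (x : A H) S T V (a : A G) :
  cls u S -> wired x T a -> total_cover S T ->
  (forall k g, V k g <-> rcomp S T k g) ->
  wired (gact u x) V a.
Proof.
move=> cu [v cv ->] F VE; exists (RBcomp u v); last by rewrite gactC.
by apply: (cls_ext _ VE); exact: cls_comp_full.
Qed.

Lemma wired_fun K H G (u : RB R K H) (f : H -> K) (x : A H) T V (a : A G) :
  cls u (fun k h => k = f h) -> wired x T a ->
  (forall k g, V k g <-> exists h, k = f h /\ T h g) -> wired (gact u x) V a.
Proof. by move=> cu wx; apply: (wired_act cu wx); left=> h; exists (f h). Qed.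

Lemma wired_trans H G K (x : A H) S T V (y : A G) (a : A K) :
  wired x S y -> wired y T a -> total_cover S T ->
  (forall h k, V h k <-> rcomp S T h k) -> wired x V a.
Proof. by move=> [u cu ->]; exact: wired_act. Qed.

Lemma wired_mul H G H' G' (x : A H) (y : A H') S T (a : A G) (b : A G') :
  wired x S a -> wired y T b ->
  wired (gmul x y)
    (fun (h : H ** H') (g : G ** G') => S h.1 g.1 /\ T h.2 g.2) (gmul a b).
Proof.
move=> [u cu ->] [v cv ->]; exists (RBprod u v); first exact: cls_prod.
by rewrite (green_act (greenP A)).
Qed.

(** Iterated compositions produce their factors in either bracketing; the associativity isomorphism
    brings them to a common one before comparison. *)
Lemma wired_assoc H G K L (x : A H) S (a : A G) (b : A K) (c : A L) :
  wired x S (gmul a (gmul b c)) ->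
  wired x (fun h (y : (G ** K) ** L) => S h (y.1.1, (y.1.2, y.2)))
    (gmul (gmul a b) c).
Proof.
rewrite -(green_assoc (greenP A)) => wx.
apply: (wired_trans wx (wired_cls _ (cls_Ind R (hassoc G K L)))).
  by right=> -[g [k l]]; exists ((g, k), l).
by rel.
Qed.

(** The unit law goes through a group isomorphism and can be inverted: the product of [geps A] and
    [a] is the restriction of [a] along [hunitl], so [geps A] drops out of normal forms. *)
Lemma wired_unitl H G (x : A H) S (a : A G) :
  wired x S (gmul (geps A) a) -> wired x (fun h y => S h (tt, y)) a.
Proof.
have -> : gmul (geps A) a = gact (G := G) (H := oone ** G) (Res R (hunitl G)) a.
  rewrite -{2}[a](green_unitl (greenP A)).
  apply: (wired_uniq (wired_id _)).
    apply: (wired_act (cls_Res R (hunitl G))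
              (wired_cls _ (cls_Ind R (hunitl G)))).
      by right=> b; exists (tt, b).
    by move=> ? ?; exact: iff_refl.
  by rel.
move=> wx; apply: (wired_trans wx (wired_cls _ (cls_Res R (hunitl G)))).
  by right=> -[[] g]; exists g.
by rel.
Qed.

Lemma wired_unitr H G (x : A H) S (a : A G) :
  wired x S (gmul a (geps A)) -> wired x (fun h y => S h (y, tt)) a.
Proof.
have -> : gmul a (geps A) = gact (G := G) (H := G ** oone) (Res R (hunitr G)) a.
  rewrite -{2}[a](green_unitr (greenP A)).
  apply: (wired_uniq (wired_id _)).
    apply: (wired_act (cls_Res R (hunitr G))
              (wired_cls _ (cls_Ind R (hunitr G)))).
      by right=> b; exists (b, tt).
    by move=> ? ?; exact: iff_refl.
  by rel.
move=> wx; apply: (wired_trans wx (wired_cls _ (cls_Res R (hunitr G)))).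
  by right=> -[g []]; exists g.
by rel.
Qed.

(** The biset behind composition in P_A is transitive: it glues the two middle copies of [G] along
    the diagonal. *)
Lemma cls_pcomp (H G K : fgroup) :
  cls (RBcomp (Ind R (hdel1 H K))
       (RBcomp (RBprod (RBprod (RBid R H) (oleft R G)) (RBid R K))
               (Ind R (hmid H G G K))))
    (fun (x : H *g K) (y : (H *g G) *g (G *g K)) =>
       [/\ x.1 = y.1.1, y.1.2 = y.2.1 & x.2 = y.2.2]).
Proof.
have co : cls (oleft R G) (fun _ x => x.1 = x.2).
  apply: (cls_ext (cls_comp_full (cls_Ind R (hto1 G)) (cls_Res R (hdiag G)) _)).
    by left=> b; exists tt.
  by rel.
have cp := cls_prod (cls_prod (cls_id R H) co) (cls_id R K).
have cph : cls
    (RBcomp (RBprod (RBprod (RBid R H) (oleft R G)) (RBid R K))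
            (Ind R (hmid H G G K)))
    (fun (x : H *g gone *g K) (y : (H *g G) *g (G *g K)) =>
       [/\ x.1.1 = y.1.1, y.1.2 = y.2.1 & x.2 = y.2.2]).
  apply: (cls_ext (cls_comp_full cp (cls_Ind R (hmid H G G K)) _)).
    by right; move=> [[h [g g']] k]; exists ((h, g), (g', k)).
  by rel.
apply: (cls_ext (cls_comp_full (cls_Ind R (hdel1 H K)) cph _)).
  by left=> -[[h []] k]; exists (h, k).
by rel.
Qed.

Lemma wired_pcomp H G K (H' K' : obj D) (b : phom A G H) (c : phom A K G)
    S T V (x : A H') (y : A K') :
  wired b S x -> wired c T y ->
  (forall g : G, exists (h : H) z, S (h, g) z) \/
    (forall g : G, exists (k : K) z, T (g, k) z) ->
  (forall (k : H ** K) (z : H' ** K'), V k z <->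
     exists g : G, S (k.1, g) z.1 /\ T (g, k.2) z.2) ->
  wired (pcomp b c) V (gmul x y).
Proof.
move=> wb wc F VE; have [u cu Ebc] := wired_mul wb wc.
exists (RBcomp (RBcomp (Ind R (hdel1 H K))
       (RBcomp (RBprod (RBprod (RBid R H) (oleft R G)) (RBid R K))
               (Ind R (hmid H G G K)))) u); last first.
  rewrite /pcomp Ebc; symmetry.
  exact: (@gactC (H ** K) ((H ** G) ** (G ** K))).
apply: cls_ext.
  apply: (cls_comp (cls_pcomp H G K) cu).
  have pM (M N : fgroup) (m m' : M) (n n' : N) :
    (gpair m n * gpair m' n')%g = gpair (m * m')%g (n * n')%g by [].
  have S1 : S 1%g 1%g by case: wb => v cv _; exact: cls1 cv.
  have T1 : T 1%g 1%g by case: wc => v cv _; exact: cls1 cv.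
  suff c0 (h : H) (g g' : G) (k : K) : exists s t x0 z0,
      [/\ gpair (gpair h g) (gpair g' k) = (s * t)%g,
          [/\ (x0 : H ** K).1 = s.1.1, s.1.2 = s.2.1 & x0.2 = s.2.2]
        & S t.1 (z0 : H' ** K').1 /\ T t.2 z0.2].
    by move=> [[h g] [g' k]]; exact: c0.
  (* The mismatch between [g] and [g'] is absorbed by the factor that covers [G]; what remains has
     equal middle coordinates. *)
  case: F => [/(_ (g'^-1 * g)%g) [h0 [z Sz]]|/(_ (g^-1 * g')%g) [k0 [z Tz]]].
    exists (gpair (gpair (h * h0^-1)%g g') (gpair g' k)).
    exists (gpair (gpair h0 (g'^-1 * g)%g) 1%g).
    exists (gpair (h * h0^-1)%g k), (gpair z 1%g).
    by split=> //; rewrite pM pM mulgKV mulKVg mulg1.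
  exists (gpair (gpair h g) (gpair g (k * k0^-1)%g)).
  exists (gpair 1%g (gpair (g^-1 * g')%g k0)).
  exists (gpair h (k * k0^-1)%g), (gpair 1%g z).
  by split=> //; rewrite pM pM mulgKV mulKVg mulg1.
move=> [h k] z; rewrite VE /=; split=> [[g [Sg Tg]]|].
  by exists ((h, g), (g, k)).
move=> [[[h1 g1] [g2 k1]]] /= [[-> -> ->]] [Sg Tg]; by exists g2.
Qed.

End Wiring.

Ltac rel_total := rel_intro; unshelve rel_goal; try exact (gid _).

Ltac wiring :=
  first [solve [left; rel_total] | solve [right; rel_total] | solve [rel]].

(** * The center *)

Section Center.
Variables (R : comPzRingType) (D : groupClass) (A : greenFunctor R D).
Implicit Types G H J K L : obj D.

Lemma wired_prho L G H G' (b : phom A G H) S (a : A G') :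
  wired b S a ->
  wired (prho L b) (fun (x : (H ** L) ** (G ** L)) y =>
    S (x.1.1, x.2.1) y /\ x.1.2 = x.2.2) a.
Proof.
move=> wb; apply: (wired_act _ wb).
- apply: (cls_comp_full (cls_Ind R (hrho H G L)) (cls_Res R (hfst (H *g G) L))).
  by right=> -[[h g] l]; exists (h, g).
- by left=> -[h g]; exists (gpair (gpair h 1%g) (gpair g 1%g)); rel.
by rel.
Qed.

Lemma wired_plam G L K G' (b : A (L ** K)) S (a : A G') :
  wired b S a ->
  wired (plam G b) (fun (x : (G ** L) ** (G ** K)) y =>
    S (x.1.2, x.2.2) y /\ x.1.1 = x.2.1) a.
Proof.
move=> wb; apply: (wired_act _ wb).
- apply: (cls_comp_full (cls_Ind R (hlam G K L)) (cls_Res R (hsnd G (L *g K)))).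
  by right=> -[g [l k]]; exists (l, k).
- by left=> -[l k]; exists (gpair (gpair 1%g l) (gpair 1%g k)); rel.
by rel.
Qed.

(** * The product on components *)

Definition pswap G K G0 (c : phom A G0 (G ** K)) : phom A (G0 ** K) G :=
  gact (H := G ** (G0 ** K)) (G := G ** K ** G0) (Ind R (hswap G G0 K)) c.

Definition ptransp H L G0 K (d : phom A (G0 ** K) (H ** L)) :
    phom A G0 (H ** (L ** K)) :=
  gact (H := H ** (L ** K) ** G0) (G := (H ** L) ** (G0 ** K))
    (Ind R (htransp H G0 K L)) d.

(* [center_mul] for one morphism of each family, with arbitrary endpoints. *)
Definition pmul G H K L G0 (b : phom A G (H ** L)) (c : phom A G0 (G ** K)) :
    phom A G0 (H ** (L ** K)) :=
  ptransp (pcomp b (pswap c)).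

Lemma wired_pswap G K G0 X (c : phom A G0 (G ** K)) S (a : A X) :
  wired c S a ->
  wired (pswap c) (fun k z => S ((k.1, k.2.2), k.2.1) z) a.
Proof.
by move=> wc; apply: (wired_fun (cls_Ind R (hswap G G0 K)) wc); rel.
Qed.

Lemma wired_ptransp H L G0 K X (d : phom A (G0 ** K) (H ** L)) S (a : A X) :
  wired d S a ->
  wired (ptransp d)
    (fun k z => S ((k.1.1, k.1.2.1), (k.2, k.1.2.2)) z) a.
Proof.
by move=> wd; apply: (wired_fun (cls_Ind R (htransp H G0 K L)) wd); rel.
Qed.

Lemma wired_pmul G H K L G0 H' K' (b : phom A G (H ** L))
    (c : phom A G0 (G ** K)) S T V (x : A H') (y : A K') :
  wired b S x -> wired c T y ->
  (forall g : G, exists (h : H ** L) z, S (h, g) z) \/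
    (forall g : G, exists (k : K) (k' : G0) z, T ((g, k), k') z) ->
  (forall (k : H ** (L ** K) ** G0) (z : H' ** K'), V k z <->
     exists g : G, S ((k.1.1, k.1.2.1), g) z.1 /\ T ((g, k.1.2.2), k.2) z.2) ->
  wired (pmul b c) V (gmul x y).
Proof.
move=> wb wc F VE; apply: (wired_ext _ VE).
have F' : (forall g : G, exists (h : H ** L) z, S (h, g) z) \/
    (forall g : G, exists (k : G0 ** K) z, T ((g, k.2), k.1) z).
  case: F => F; [by left|right=> g; have [k [k' [z Tz]]] := F g].
  by exists (k', k), z.
have wbc := wired_pcomp wb (wired_pswap wc) F' (fun _ _ => iff_refl _).
exact: wired_ptransp wbc.
Qed.

(** Both sides glue [a], [b], [c] along [G] and [G0], leaving the coordinates in [L] and [K]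
    free. *)
Lemma prho_pmul G H K L G0 G1 (a : phom A G H) (b : phom A G0 (G ** L))
    (c : phom A G1 (G0 ** K)) :
  pcomp (prho (L ** K) a) (pmul b c) = pmul (pcomp (prho L a) b) c.
Proof.
(* [iff_refl] lets unification compute the composite relation; the covering conditions are
   abstracted here and become goals at the end. *)
have wl := wired_pcomp (wired_prho (L ** K) (wired_id a))
  (wired_pmul (wired_id b) (wired_id c) _ (fun _ _ => iff_refl _)) _
  (fun _ _ => iff_refl _).
have wr := wired_pmul (wired_pcomp (wired_prho L (wired_id a)) (wired_id b)
   _ (fun _ _ => iff_refl _)) (wired_id c) _ (fun _ _ => iff_refl _).
apply: (wired_uniq (wired_assoc (wl _ _)) (wr _ _)); wiring.
Qed.

(** The same kind of gluing; it lets a morphism cross from the first factor of [pmul] to the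
    second. *)
Lemma pmul_pcompl G H K L G0 G1 (b : phom A G (H ** L)) (a : phom A G0 G)
    (c : phom A G1 (G0 ** K)) :
  pmul (pcomp b a) c = pmul b (pcomp (prho K a) c).
Proof.
have wl := wired_pmul
  (wired_pcomp (wired_id b) (wired_id a) _ (fun _ _ => iff_refl _))
  (wired_id c) _ (fun _ _ => iff_refl _).
have wr := wired_pmul (wired_id b)
  (wired_pcomp (wired_prho K (wired_id a)) (wired_id c) _
     (fun _ _ => iff_refl _)) _ (fun _ _ => iff_refl _).
apply: (wired_uniq (wl _ _) (wired_assoc (wr _ _))); wiring.
Qed.

Lemma pcomp_pmul G H K L G0 G1 (b : phom A G (H ** L)) (c : phom A G0 (G ** K))
    (a : phom A G1 G0) :
  pcomp (pmul b c) a = pmul b (pcomp c a).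
Proof.
have wl := wired_pcomp
  (wired_pmul (wired_id b) (wired_id c) _ (fun _ _ => iff_refl _))
  (wired_id a) _ (fun _ _ => iff_refl _).
have wr := wired_pmul (wired_id b)
  (wired_pcomp (wired_id c) (wired_id a) _ (fun _ _ => iff_refl _)) _
  (fun _ _ => iff_refl _).
apply: (wired_uniq (wl _ _) (wired_assoc (wr _ _))); wiring.
Qed.

Lemma pmul_linearl G H K L G0 (c : phom A G0 (G ** K)) :
  linear (fun b : phom A G (H ** L) => pmul b c).
Proof. by move=> a x y; rewrite /pmul pcomp_linearl /ptransp gact_linear. Qed.

Lemma pmul_linearr G H K L G0 (b : phom A G (H ** L)) :
  linear (fun c : phom A G0 (G ** K) => pmul b c).
Proof.
move=> a x y; rewrite /pmul /pswap gact_linear pcomp_linearr.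
by rewrite /ptransp gact_linear.
Qed.

Lemma plam_linear G L K : linear (fun b : A (L ** K) => plam G b).
Proof. by move=> a x y; rewrite /plam gact_linear. Qed.

Lemma gact_linear_mor G H (a : A G) : linear (fun u : RB R H G => gact u a).
Proof. exact: act_linear_mor (green_functor (greenP A)) _ _ a. Qed.

(** * The action on components *)

(** With [H = G] this is the component of [ZA(u)(t)], by [center_actE]; in this form functoriality
    in [u] comes from that of [A]. *)
Definition pmid H L K G (u : RB R L K) (a : phom A G (H ** K)) :
    phom A G (H ** L) :=
  gact (H := H ** L ** G) (G := H ** K ** G)
    (RBprod (RBprod (RBid R H) u) (RBid R G)) a.

Lemma pmid_linearl H L K G (a : phom A G (H ** K)) :
  linear (fun u : RB R L K => pmid u a).
Proof.
move=> x u v; rewrite /pmid RBprod_linearr RBprod_linearl.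
by rewrite (@gact_linear_mor (H ** K ** G) (H ** L ** G)).
Qed.

Lemma pmid_linearr H L K G (u : RB R L K) :
  linear (fun a : phom A G (H ** K) => pmid u a).
Proof. exact: gact_linear. Qed.

Lemma pmid_comp H L J K G (v : RB R L J) (u : RB R J K)
    (a : phom A G (H ** K)) :
  pmid (RBcomp v u) a = pmid v (pmid u a).
Proof.
(* The outer identities must be written as composites before the interchange law applies. *)
have idC (M : fgroup) : RBid R M = RBcomp (RBid R M) (RBid R M).
  apply: (cls_uniq (cls_id R M)).
  apply: (cls_ext (cls_comp_full (cls_id R M) (cls_id R M) _)); last by rel.
  by left=> m; exists m.
rewrite /pmid -(@gactC _ _ _ (H ** L ** G) (H ** J ** G)) -!RBprod_comp.
by rewrite -!idC.
Qed.

(** The second alternative matters for an arbitrary [U], which need not cover [K]; identity wirings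
    satisfy it. *)
Lemma wired_pmid H L K G X (u : RB R L K) (b : phom A G (H ** K)) U T V
    (a : A X) :
  cls u U -> wired b T a ->
  (forall k : K, exists l, U l k) \/ (forall y, exists z, T y z) ->
  (forall (y : H ** L ** G) z, V y z <->
     exists k : K, U y.1.2 k /\ T ((y.1.1, k), y.2) z) ->
  wired (pmid u b) V a.
Proof.
move=> cu wb F VE.
apply: (wired_act (cls_prod (cls_prod (cls_id R H) cu) (cls_id R G)) wb).
  case: F => F; [left=> -[[h k] g]|by right].
  by have [l Ul] := F k; exists (gpair (gpair h l) g).
move=> y z; rewrite VE; split=> [[k [Uk Tk]]|[[[h k] g] [[[/= <- Uk] <-] Tk]]].
  by exists (gpair (gpair y.1.1 k) y.2).
by exists k.
Qed.

Lemma pmid_id H K G (a : phom A G (H ** K)) : pmid (RBid R K) a = a.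
Proof.
have w := wired_pmid (cls_id R K) (wired_id a) _ (fun _ _ => iff_refl _).
by apply: (wired_uniq (w _) (wired_id a)); wiring.
Qed.

Lemma prho_pmid L K G H G0 (u : RB R L K) (a : phom A G H)
    (b : phom A G0 (G ** K)) :
  pcomp (prho L a) (pmid u b) = pmid u (pcomp (prho K a) b).
Proof.
move: u; apply: RB_linear_eq => [x u v|x u v|u U cu].
- by rewrite pmid_linearl pcomp_linearr.
- by rewrite pmid_linearl.
have wl := wired_pcomp (wired_prho L (wired_id a))
  (wired_pmid cu (wired_id b) _ (fun _ _ => iff_refl _)) _
  (fun _ _ => iff_refl _).
have wr := wired_pmid cu
  (wired_pcomp (wired_prho K (wired_id a)) (wired_id b) _
     (fun _ _ => iff_refl _)) _ (fun _ _ => iff_refl _).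
by apply: (wired_uniq (wl _ _) (wr _ _)); wiring.
Qed.

Lemma pcomp_pmid L K G H G0 (u : RB R L K) (b : phom A G (H ** K))
    (a : phom A G0 G) :
  pcomp (pmid u b) a = pmid u (pcomp b a).
Proof.
move: u; apply: RB_linear_eq => [x u v|x u v|u U cu].
- by rewrite pmid_linearl pcomp_linearl.
- by rewrite pmid_linearl.
have wl := wired_pcomp
  (wired_pmid cu (wired_id b) _ (fun _ _ => iff_refl _)) (wired_id a) _
  (fun _ _ => iff_refl _).
have wr := wired_pmid cu
  (wired_pcomp (wired_id b) (wired_id a) _ (fun _ _ => iff_refl _)) _
  (fun _ _ => iff_refl _).
by apply: (wired_uniq (wl _ _) (wr _ _)); wiring.
Qed.

(** [u] and [v] act on the coordinates in [L] and [K], which the gluing along [G] does not touch. *)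
Lemma pmid_pmul L L' K K' G H G0 (u : RB R L' L) (v : RB R K' K)
    (b : phom A G (H ** L)) (c : phom A G0 (G ** K)) :
  pmid (RBprod u v : RB R (L' ** K') (L ** K)) (pmul b c)
  = pmul (pmid u b) (pmid v c).
Proof.
move: u; apply: RB_linear_eq => [x u w|x u w|u U cu].
- rewrite -(@pmid_linearl H (L' ** K') (L ** K)); congr pmid.
  exact: RBprod_linearl.
- by rewrite pmid_linearl pmul_linearl.
move: v; apply: RB_linear_eq => [x v w|x v w|v V cv].
- rewrite -(@pmid_linearl H (L' ** K') (L ** K)); congr pmid.
  exact: RBprod_linearr.
- by rewrite pmid_linearl pmul_linearr.
have wl := @wired_pmid H (L' ** K') (L ** K) _ _ _ _ _ _ _ _ (cls_prod cu cv)
  (wired_pmul (wired_id b) (wired_id c) _ (fun _ _ => iff_refl _))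
  _ (fun _ _ => iff_refl _).
have wr := wired_pmul
  (wired_pmid cu (wired_id b) _ (fun _ _ => iff_refl _))
  (wired_pmid cv (wired_id c) _ (fun _ _ => iff_refl _))
  _ (fun _ _ => iff_refl _).
(* Covering [G] by the first factor requires one pair in [U]; the pair of identities is always
   there. *)
have U1 := cls1 cu.
by apply: (wired_uniq (wl _ _) (wr _ _ _)); wiring.
Qed.

(** Both products glue [b], [c], [d] along [G] and [G0]; only the bracketing of [J], [K], [L]
    differs. *)
Lemma pmul_assoc G H G0 G1 J K L (b : phom A G (H ** J))
    (c : phom A G0 (G ** K)) (d : phom A G1 (G0 ** L)) :
  pmid (Ind R (hassoc J K L) : RB R (J ** (K ** L)) (J ** K ** L))
    (pmul (pmul b c) d)
  = pmul b (pmul c d).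
Proof.
have wl := @wired_pmid H (J ** (K ** L)) (J ** K ** L) _ _ _ _ _ _ _ _
  (cls_Ind R (hassoc J K L))
  (wired_pmul (wired_pmul (wired_id b) (wired_id c) _ (fun _ _ => iff_refl _))
     (wired_id d) _ (fun _ _ => iff_refl _)) _ (fun _ _ => iff_refl _).
have wr := wired_pmul (wired_id b)
  (wired_pmul (wired_id c) (wired_id d) _ (fun _ _ => iff_refl _)) _
  (fun _ _ => iff_refl _).
by apply: (wired_uniq (wl _ _ _) (wired_assoc (wr _ _))); wiring.
Qed.

(** * The unit on components *)

Lemma wired_one G : wired (center_one A G)
  (fun (x : G ** oone ** G) (_ : @oone D) => x.1.1 = x.2) (geps A).
Proof.
have wp : wired (pid A G)
    (fun (x : G ** G) (_ : @oone D) => x.1 = x.2) (geps A).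
  apply: wired_cls.
  apply: (cls_ext (cls_comp_full (cls_Ind R (hdiag G)) (cls_Res R (hto1 G)) _)).
    by right=> g; exists tt.
  by rel.
by apply: (wired_fun (cls_Ind R (hins1 G G)) wp); rel.
Qed.

(** Gluing with the diagonal of [G] changes nothing, and the factor [geps A] is removed by
    [wired_unitl]. *)
Lemma pmul_onel G K G0 (c : phom A G0 (G ** K)) :
  pmid (Ind R (hunitl K) : RB R K (oone ** K)) (pmul (center_one A G) c) = c.
Proof.
have w := @wired_pmid G K (oone ** K) _ _ _ _ _ _ _ _ (cls_Ind R (hunitl K))
  (wired_pmul (wired_one G) (wired_id c) _ (fun _ _ => iff_refl _))
  _ (fun _ _ => iff_refl _).
by apply: (wired_uniq (wired_unitl (w _ _)) (wired_id c)); wiring.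
Qed.

Lemma pmul_oner G H K (b : phom A G (H ** K)) :
  pmid (Ind R (hunitr K) : RB R K (K ** oone)) (pmul b (center_one A G)) = b.
Proof.
have w := @wired_pmid H K (K ** oone) _ _ _ _ _ _ _ _ (cls_Ind R (hunitr K))
  (wired_pmul (wired_id b) (wired_one G) _ (fun _ _ => iff_refl _))
  _ (fun _ _ => iff_refl _).
by apply: (wired_uniq (wired_unitr (w _ _)) (wired_id b)); wiring.
Qed.

(** * Action, product and unit of the center *)

(** The element u_A is [u], read as a set, applied to [geps A]; composing with G x u_A glues along
    GK, which leaves [u] acting on the coordinate in [K]. *)
Lemma center_actE L K (u : RB R L K) (t : ZA A K) G :
  center_act u t G = pmid u (t G).
Proof.
move: u; apply: RB_linear_eq => [a u v|a u v|u U cu].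
- rewrite /center_act /image_in /upsilon (@RBset_linear R L K).
  by rewrite (@gact_linear_mor oone (L ** K)) plam_linear pcomp_linearl.
- by rewrite pmid_linearl.
have wl := wired_pcomp
  (wired_plam G
     (wired_cls (H := L ** K) (G := oone) (geps A) (cls_set cu)))
  (wired_id (t G)) _ (fun _ _ => iff_refl _).
have wr := wired_pmid cu (wired_id (t G)) _ (fun _ _ => iff_refl _).
by apply: (wired_uniq (wired_unitl (wl _)) (wr _)); wiring.
Qed.

Lemma center_mulE L K (t : ZA A L) (s : ZA A K) G :
  center_mul t s G = pmul (t G) (s G).
Proof. by []. Qed.

Lemma center_act_natural L K (u : RB R L K) (t : ZA A K) :
  is_natural (center_act u t).
Proof.
by move=> G H a; rewrite !center_actE prho_pmid centerP pcomp_pmid.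
Qed.

(** The morphism [a] moves through the product: past [t] by naturality, across to the second factor
    by [pmul_pcompl], past [s] by naturality, and out on the right. *)
Lemma center_mul_natural L K (t : ZA A L) (s : ZA A K) :
  is_natural (center_mul t s).
Proof.
move=> G H a; rewrite !center_mulE prho_pmul centerP pmul_pcompl centerP.
by rewrite pcomp_pmul.
Qed.

Lemma center_one_natural : is_natural (center_one A).
Proof.
move=> G H a.
have wl := wired_pcomp (wired_prho oone (wired_id a)) (wired_one G) _
  (fun _ _ => iff_refl _).
have wr := wired_pcomp (wired_one H) (wired_id a) _ (fun _ _ => iff_refl _).
by apply: (wired_uniq (wired_unitr (wl _)) (wired_unitl (wr _))); wiring.
Qed.

End Center.

(** By [center_ext] the equations on components determine [act], [mul] and [one]. *)
Theorem theorem38 (R : comPzRingType) (D : groupClass) (A : greenFunctor R D) :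
  exists (act : forall L K : obj D, RB R L K -> ZA A K -> ZA A L)
         (mul : forall L K : obj D, ZA A L -> ZA A K -> ZA A (L ** K))
         (one : ZA A oone),
    (forall (L K : obj D) (u : RB R L K) (t : ZA A K) (G : obj D),
       act L K u t G = center_act u t G) /\
    (forall (L K : obj D) (t : ZA A L) (s : ZA A K) (G : obj D),
       mul L K t s G = center_mul t s G) /\
    (forall G : obj D, one G = center_one A G) /\
    is_green_functor act mul one.
Proof.
exists (fun L K u t => Center (center_act_natural u t)).
exists (fun L K t s => Center (center_mul_natural t s)).
exists (Center (center_one_natural (A := A))).
split=> //; split=> //; split=> //.
(* Sum and scaling on the center are instances of [center_lin], which leave a factor [1] and a
   summand [0]. *)
have linE K (a : R) (s t : ZA A K) G : (a *: s + t) G = a *: s G + t G.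
  by rewrite /= scale1r addr0.
split.
(* Every axiom is compared component by component, with [pmid] for the action and [pmul] for the
   product. *)
- split.
  + move=> H K u a s t; apply: center_ext => G; rewrite linE /= !center_actE.
    by rewrite linE pmid_linearr.
  + move=> H K s a u v; apply: center_ext => G; rewrite linE /= !center_actE.
    by rewrite pmid_linearl.
  + by move=> K s; apply: center_ext => G; rewrite /= center_actE pmid_id.
  + move=> K H L v u s; apply: center_ext => G; rewrite /= !center_actE /=.
    by rewrite center_actE pmid_comp.
- move=> G H s a x y; apply: center_ext => K; rewrite linE /= !center_mulE.
  by rewrite linE pmul_linearl.
- move=> G H s a x y; apply: center_ext => K; rewrite linE /= !center_mulE.
  by rewrite linE pmul_linearr.
- move=> G H K b c d; apply: center_ext => J.
  by rewrite /= center_actE /= !center_mulE pmul_assoc.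
- move=> K s; apply: center_ext => G.
  by rewrite /= center_actE /= center_mulE pmul_onel.
- move=> K s; apply: center_ext => G.
  by rewrite /= center_actE /= center_mulE pmul_oner.
move=> G H G' H' u v s t; apply: center_ext => J.
by rewrite /= center_actE /= !center_mulE /= !center_actE pmid_pmul.
Qed.
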